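(* Let $M$ be a manifold, $E$ an oriented vector bundle over $M$ of rank $4n$, $h$ a neutral metric of $E$, and $\nabla$ an $h$-connection of $E$ (a connection with $\nabla h=0$). Let $\varepsilon\in\{+,-\}$, let $N$ be an $\varepsilon$-nilpotent structure of $(E,h)$, and suppose that $N$ is an $H$-nilpotent structure of $(E,h)$. Let $\pi_N:={\rm Im}\,N={\rm Ker}\,N$. (a) There exists a unique light-like subbundle $\pi_N^\times$ of $(E,h)$ of rank $2n$ which is locally spanned by $$\xi'_1:=e_1+e_{2n+1},\quad \xi'_i:=e_i+e_{2n+i},\quad \xi'_{n+1}:=e_{n+1}-\varepsilon e_{3n+1},\quad \xi'_{n+i}:=e_{n+i}-e_{3n+i}\quad(i=2,\dots,n)$$ for any $H$-admissible frame field $e=(e_1,\dots,e_{4n})$ of $N$. In particular, $E=\pi_N\oplus\pi_N^\times$. (b) There exists a unique $\varepsilon$-nilpotent and $H$-nilpotent structure $N^\times$ of $(E,h)$ such that each $H$-admissible frame field of $N^\times$ is given by $e'=(e_1,\dots,e_{2n},-e_{2n+1},\dots,-e_{4n})$ for an $H$-admissible frame field $e$ of $N$. In particular, $\pi_{N^\times}=\pi_N^\times$. (c) The condition that $N$ is an $H$-nilpotent structure of $(E,h,\nabla)$ is equivalent to the condition that $N^\times$ is an $H$-nilpotent structure of $(E,h,\nabla)$.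
   Context: Everything is smooth. $h$ neutral means that $h$ is a bundle metric of signature $(2n,2n)$. A subbundle is light-like if $h$ vanishes on it. An ordered pseudo-orthonormal local frame field $e=(e_1,\dots,e_{4n})$ of $(E,h)$ always has $e_1,\dots,e_{2n}$ space-like ($h(e_i,e_i)=1$) and $e_{2n+1},\dots,e_{4n}$ time-like ($h(e_i,e_i)=-1$). Set $I_{1,\pm}:=\pm1$ and $I_{n,\pm}:={\rm diag}(\pm1,1,\dots,1)$ ($n\times n$) for $n\ge2$; $I'_{4n,\varepsilon}:={\rm diag}(I_n,I_n,I_n,I_{n,\varepsilon})$ (block diagonal), and $$\Lambda_n:=\left[\begin{array}{cccc}O_n&-I_n&O_n&I_n\\ I_n&O_n&I_n&O_n\\ O_n&I_n&O_n&-I_n\\ I_n&O_n&I_n&O_n\end{array}\right],$$ with $I_n$, $O_n$ the $n\times n$ unit and zero matrices. A section $N$ of ${\rm End}\,E$ is an $\varepsilon$-nilpotent structure of $(E,h)$ if on a neighborhood of each point of $M$ there is an ordered pseudo-orthonormal local frame field $e$ of $(E,h)$ giving the orientation of $E$ with $NeI'_{4n,\varepsilon}=eI'_{4n,\varepsilon}\Lambda_n$ (frames are treated as row vectors); such an $e$ is called an admissible frame field of $N$. $H$ is the Lie subgroup of $SO(2n,2n)$ consisting of all elements of $SO(2n,2n)$ of the form (with $n\times n$ blocks) $$\left[\begin{array}{cccc}A_{11}&-A_{21}&A_{31}&A_{41}\\ A_{21}&A_{11}&-A_{41}&A_{31}\\ A_{31}&-A_{41}&A_{11}&A_{21}\\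 A_{41}&A_{31}&-A_{21}&A_{11}\end{array}\right].$$ An $\varepsilon$-nilpotent structure $N$ of $(E,h)$ is called an $H$-nilpotent structure of $(E,h)$ if there exist an open cover $\{U_\lambda\}_{\lambda\in\Lambda}$ of $M$ and a family $\{e_\lambda\}_{\lambda\in\Lambda}$ of admissible frame fields of $N$ such that (i) each $e_\lambda$ is defined on $U_\lambda$; (ii) if $U_\lambda\cap U_\mu\ne\emptyset$, then $e_\mu I'_{4n,\varepsilon}=e_\lambda I'_{4n,\varepsilon}A_{\lambda\mu}$ on $U_\lambda\cap U_\mu$ for a function $A_{\lambda\mu}$ valued in $H$. Such a family determines a principal $H$-bundle $P$ over $M$ associated with $E$, of which each $e_\lambda I'_{4n,\varepsilon}$ is a local section. An $H$-nilpotent structure $N$ is considered together with this bundle $P$. An admissible frame field $e$ of $N$ defined on an open set $U$ is an $H$-admissible frame field of $N$ if $eI'_{4n,\varepsilon}$ is a local section of $P$, i.e., if for each $\lambda$ with $U\cap U_\lambda\ne\emptyset$ there is an $H$-valued function $A_\lambda$ on $U\cap U_\lambda$ with $eI'_{4n,\varepsilon}=e_\lambda I'_{4n,\varepsilon}A_\lambda$. $N$ (with its bundle $P$) is an $H$-nilpotent structure of $(E,h,\nabla)$ if in addition (iii) the connection form $\omega_\lambda$ of $\nabla$ with respect to $e_\lambda I'_{4n,\varepsilon}$, defined by $\nabla(e_\lambda I'_{4n,\varepsilon})=e_\lambda I'_{4n,\varepsilon}\omega_\lambda$, is valued in the Lie algebra of $H$ for each $\lambda$ (equivalently, the same holds for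 every $H$-admissible frame field). *)

(* Defs.v *)
From HB Require Import structures.
From mathcomp Require Import all_boot all_order all_algebra.
From mathcomp Require Import all_classical all_reals all_analysis.

Set Implicit Arguments.
Unset Strict Implicit.
Unset Printing Implicit Defensive.

Import Order.TTheory GRing.Theory Num.Theory.
Import numFieldNormedType.Exports.

Local Open Scope classical_set_scope.
Local Open Scope ring_scope.

(* Throughout, fields of vectors (sections, frames, functions, ...) that are
   only meaningful on an open set are represented by total functions, whose
   values outside that set are irrelevant. *)

Section Smooth.
Context {R : realType}.

(* [U] is meant to be open. *)
Fixpoint Ck (m : nat) (k : nat) (U : set 'rV[R]_m) (f : 'rV[R]_m -> R) : Prop :=
  (forall x, U x -> {for x, continuous f}) /\
  match k with
  | 0 => True
  | k'.+1 => forall j : 'I_m,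
      (forall x, U x -> derivable f x (delta_mx 0 j)) /\
      Ck k' U (fun x => 'D_(delta_mx 0 j) f x)
  end.

Definition Cinfty (m : nat) (U : set 'rV[R]_m) (f : 'rV[R]_m -> R) : Prop :=
  forall k, Ck k U f.

Record chart (T : topologicalType) (m : nat) := Chart {
  cdom : set T;
  cmap : T -> 'rV[R]_m;
  cinv : 'rV[R]_m -> T }.

Definition is_chart (T : topologicalType) (m : nat) (c : chart T m) : Prop :=
  [/\ open (cdom c), open (cmap c @` cdom c),
      {in cdom c, cancel (cmap c) (cinv c)},
      (forall x, cdom c x -> {for x, continuous (cmap c)}) &
      (forall y, (cmap c @` cdom c) y -> {for y, continuous (cinv c)})].

End Smooth.

Arguments chart : clear implicits.

Record manifold (R : realType) (m : nat) := Manifold {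
  carrier :> topologicalType;
  manifold_hausdorff : hausdorff_space carrier;
  manifold_second_countable : @second_countable carrier;
  atlas : set (chart R carrier m);
  atlas_chart : forall c, atlas c -> is_chart c;
  atlas_cover : forall x : carrier, exists2 c, atlas c & cdom c x;
  atlas_smooth : forall c c', atlas c -> atlas c' -> forall j : 'I_m,
    Cinfty (cmap c @` (cdom c `&` cdom c')) (fun y => cmap c' (cinv c y) 0 j) }.

Section Manifold.
Context {R : realType} {m : nat} (M : manifold R m).

Definition smooth_on (W : set M) (f : M -> R) : Prop :=
  forall c, atlas c -> Cinfty (cmap c @` (W `&` cdom c)) (fun y => f (cinv c y)).

(* A tangent vector at [x] is the family of its components in the charts at
   [x], subject to the usual transformation law; the entries at the irrelevant
   charts are set to 0 so that each tangent vector has a single representative. *)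
Definition tvec := chart R M m -> 'rV[R]_m.

Definition tangent (x : M) (v : tvec) : Prop :=
  (forall c, ~ (atlas c /\ cdom c x) -> v c = 0) /\
  (forall c c', atlas c -> atlas c' -> cdom c x -> cdom c' x -> forall k : 'I_m,
     v c' 0 k = \sum_(j < m) v c 0 j *
       'D_(delta_mx 0 j) (fun y => cmap c' (cinv c y) 0 k) (cmap c x)).

Definition smooth_vfield (W : set M) (X : M -> tvec) : Prop :=
  (forall x, W x -> tangent x (X x)) /\
  (forall c (j : 'I_m), atlas c -> smooth_on (W `&` cdom c) (fun x => X x c 0 j)).

(* The derivative of [f] at [x] along [v], computed in the chart [c]; by the
   chain rule it does not depend on the chart [c] of the atlas at [x]. *)
Definition tderiv (c : chart R M m) (x : M) (v : tvec) (f : M -> R) : R :=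
  \sum_(j < m) v c 0 j * 'D_(delta_mx 0 j) (fun y => f (cinv c y)) (cmap c x).

End Manifold.

Record triv (R : realType) (T : Type) (F : T -> vectType R) (r : nat) := Triv {
  tdom : set T;
  tmap : forall x, 'Hom(F x, 'rV[R]_r) }.

(* A smooth oriented vector bundle given by a bundle atlas: local
   trivializations that are linear isomorphisms on the fibres over their domains
   and differ by smooth GL^+(r)-valued functions. *)
Record oriented_bundle (R : realType) (m : nat) (M : manifold R m) (r : nat) :=
  OrientedBundle {
  fiber :> M -> vectType R;
  batlas : set (triv fiber r);
  batlas_open : forall t, batlas t -> open (tdom t);
  batlas_cover : forall x : M, exists2 t, batlas t & tdom t x;
  batlas_bij : forall t, batlas t -> forall x, tdom t x -> bijective (tmap t x);
  batlas_smooth : forall t t', batlas t -> batlas t' ->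
    exists g : M -> 'M[R]_r,
      (forall i j, smooth_on (tdom t `&` tdom t') (fun x => g x i j)) /\
      (forall x, tdom t x -> tdom t' x ->
         0 < \det (g x) /\ forall v, tmap t' x v = tmap t x v *m g x) }.

Section Bundle.
Context {R : realType} {m : nat} {M : manifold R m} {r : nat}.
Variable E : oriented_bundle M r.

Definition section := forall x : M, E x.

Definition smooth_section (W : set M) (s : section) : Prop :=
  forall t (j : 'I_r), batlas t ->
    smooth_on (W `&` tdom t) (fun x => tmap t x (s x) 0 j).

Definition endo_field := forall x : M, 'End(E x).

Definition smooth_endo (N : endo_field) : Prop :=
  forall (W : set M) (s : section), open W -> smooth_section W s ->
    smooth_section W (fun x => N x (s x)).

Definition is_subbundle (k : nat) (p : forall x : M, {vspace E x}) : Prop :=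
  (forall x, \dim (p x) = k) /\
  (forall x, exists (W : set M) (s : 'I_k -> section),
    [/\ open W, W x, (forall i, smooth_section W (s i)) &
        forall y, W y -> p y = <<[seq s i y | i : 'I_k]>>%VS]).

Record frame := Frame {
  fdom : set M;
  fvec :> forall x : M, 'I_r -> E x }.

Definition is_frame (e : frame) : Prop :=
  [/\ open (fdom e), (forall i, smooth_section (fdom e) (fun x => e x i)) &
      forall x, fdom e x -> basis_of fullv [seq e x i | i : 'I_r]].

Definition positive_frame (e : frame) : Prop :=
  forall t x, batlas t -> tdom t x -> fdom e x ->
    0 < \det (\matrix_(i, j) tmap t x (e x i) 0 j).

Definition bform := forall x : M, E x -> E x -> R.

Record is_connection (nabla : forall x : M, tvec M -> section -> E x) : Prop :=
  IsConnection {
  (* [nabla x v s] only depends on the germ of [s] at [x] *)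
  conn_local : forall x v (W : set M) (s s' : section), tangent x v ->
    open W -> W x -> smooth_section W s -> smooth_section W s' ->
    (forall y, W y -> s y = s' y) -> nabla x v s = nabla x v s';
  conn_linear : forall x a v w (W : set M) (s : section), tangent x v ->
    tangent x w -> open W -> W x -> smooth_section W s ->
    nabla x (fun c => a *: v c + w c) s = a *: nabla x v s + nabla x w s;
  conn_additive : forall x v (W : set M) (s s' : section), tangent x v ->
    open W -> W x -> smooth_section W s -> smooth_section W s' ->
    nabla x v (fun y => s y + s' y) = nabla x v s + nabla x v s';
  conn_leibniz : forall x v c (W : set M) (f : M -> R) (s : section),
    tangent x v -> atlas c -> cdom c x ->
    open W -> W x -> smooth_on W f -> smooth_section W s ->
    nabla x v (fun y => f y *: s y) = tderiv c x v f *: s x + f x *: nabla x v s;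
  conn_smooth : forall (W : set M) (X : M -> tvec M) (s : section), open W ->
    smooth_vfield W X -> smooth_section W s ->
    smooth_section W (fun x => nabla x (X x) s) }.

Definition metric_connection (h : bform)
    (nabla : forall x : M, tvec M -> section -> E x) : Prop :=
  forall x v c (W : set M) (s s' : section),
    tangent x v -> atlas c -> cdom c x ->
    open W -> W x -> smooth_section W s -> smooth_section W s' ->
    tderiv c x v (fun y => h y (s y) (s' y)) =
      h x (nabla x v s) (s' x) + h x (s x) (nabla x v s').

Definition light_like (h : bform) (p : forall x : M, {vspace E x}) : Prop :=
  forall x u v, u \in p x -> v \in p x -> h x u v = 0.

End Bundle.

(* The product of a row of vectors with a matrix. *)
Definition fmul (R : realType) (V : vectType R) (r : nat)
    (b : 'I_r -> V) (A : 'M[R]_r) : 'I_r -> V :=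
  fun j => \sum_(i < r) A i j *: b i.

(* The Lie algebra of a linear Lie group, as its tangent space at the identity. *)
Definition lie_algebra (R : realType) (r : nat) (G : set 'M[R]_r) : set 'M[R]_r :=
  [set X | exists (d : R) (g : R -> 'M[R]_r),
    [/\ 0 < d, g 0 = 1%:M,
        (forall t, `|t| < d -> G (g t)),
        (forall k t i j, `|t| < d -> derivable (derive1n k (fun u => g u i j)) t 1) &
        forall i j, X i j = derive1 (fun u => g u i j) 0]].

(* 4n, split as 2n + 2n with 2n = n + n to match nested block matrices. *)
Notation rk n := (n + n + (n + n))%N.

Section Matrices.
Context {R : realType} {n : nat}.

(* The sign epsilon is a boolean: [true] is +, [false] is -. *)
Definition sgn (eps : bool) : R := if eps then 1 else -1.

(* The k-th diagonal entry (from 0) of I_{n,eps}. *)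
Definition deps (eps : bool) (k : 'I_n) : R :=
  if (k : nat) == 0%N then sgn eps else 1.

Definition Ieps (eps : bool) : 'M[R]_n := diag_mx (\row_k deps eps k).

Definition I'eps (eps : bool) : 'M[R]_(rk n) :=
  block_mx (block_mx 1%:M 0 0 1%:M) 0 0 (block_mx 1%:M 0 0 (Ieps eps)).

Definition Lambda : 'M[R]_(rk n) :=
  block_mx (block_mx 0 (- 1%:M) 1%:M 0) (block_mx 0 1%:M 1%:M 0)
           (block_mx 0 1%:M 1%:M 0) (block_mx 0 (- 1%:M) 1%:M 0).

Definition eta : 'M[R]_(rk n) := block_mx 1%:M 0 0 (- 1%:M).

Definition SOnn : set 'M[R]_(rk n) :=
  [set A | A^T *m eta *m A = eta /\ \det A = 1].

Definition Hgroup : set 'M[R]_(rk n) :=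
  [set A | SOnn A /\ exists A11 A21 A31 A41 : 'M[R]_n,
    A = block_mx (block_mx A11 (- A21) A21 A11) (block_mx A31 A41 (- A41) A31)
                 (block_mx A31 (- A41) A41 A31) (block_mx A11 A21 (- A21) A11)].

Variable V : vectType R.

Definition blk1 (i : 'I_n) : 'I_(rk n) := lshift (n + n) (lshift n i).
Definition blk2 (i : 'I_n) : 'I_(rk n) := lshift (n + n) (rshift n i).
Definition blk3 (i : 'I_n) : 'I_(rk n) := rshift (n + n) (lshift n i).
Definition blk4 (i : 'I_n) : 'I_(rk n) := rshift (n + n) (rshift n i).

(* xi'_1, ..., xi'_{2n} *)
Definition xi' (eps : bool) (b : 'I_(rk n) -> V) (k : 'I_(n + n)) : V :=
  match fintype.split k with
  | inl i => b (blk1 i) + b (blk3 i)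
  | inr i => b (blk2 i) - deps eps i *: b (blk4 i)
  end.

(* (e_1, ..., e_{2n}, - e_{2n+1}, ..., - e_{4n}) *)
Definition flip (b : 'I_(rk n) -> V) (i : 'I_(rk n)) : V :=
  match fintype.split i with inl _ => b i | inr _ => - b i end.

End Matrices.

Arguments Lambda {R n}.
Arguments eta {R n}.
Arguments Hgroup {R n}.

Section Nilpotent.
Context {R : realType} {m n : nat} {M : manifold R m}.
Variable E : oriented_bundle M (rk n).
Variable eps : bool.

Record neutral_metric (h : bform E) : Prop := NeutralMetric {
  nm_sym : forall x u v, h x u v = h x v u;
  nm_linear : forall x a u v w, h x (a *: u + v) w = a * h x u w + h x v w;
  nm_smooth : forall (W : set M) (s s' : section E), open W ->
    smooth_section W s -> smooth_section W s' ->
    smooth_on W (fun x => h x (s x) (s' x));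
  nm_signature : forall x, exists b : 'I_(rk n) -> E x,
    basis_of fullv [seq b i | i : 'I_(rk n)] /\
    forall i j, h x (b i) (b j) = eta i j }.

Definition admissible (h : bform E) (N : endo_field E) (e : frame E) : Prop :=
  [/\ is_frame e, positive_frame e,
      (forall x i j, fdom e x -> h x (e x i) (e x j) = eta i j) &
      forall x j, fdom e x ->
        N x (fmul (e x) (I'eps eps) j) = fmul (e x) (I'eps eps *m Lambda) j].

Definition nilpotent_structure (h : bform E) (N : endo_field E) : Prop :=
  smooth_endo N /\ forall x, exists2 e, admissible h N e & fdom e x.

(* [e' I' = e I' A] over the common domain for a function [A] valued in [H];
   [A] is unique there and, its entries being +-h of the frame vectors,
   automatically smooth. *)
Definition H_related (e e' : frame E) : Prop :=
  exists A : M -> 'M[R]_(rk n), forall x, fdom e x -> fdom e' x ->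
    Hgroup (A x) /\
    forall j, fmul (e' x) (I'eps eps) j = fmul (e x) (I'eps eps *m A x) j.

(* The bundle P is presented by the family [F] of frames e_lambda (each
   carrying its domain U_lambda); its local sections are e I' for the frames [e]
   satisfying [H_admissible h N F] below. *)
Definition H_nilpotent (h : bform E) (N : endo_field E) (F : set (frame E)) : Prop :=
  [/\ nilpotent_structure h N,
      (forall e, F e -> admissible h N e),
      (forall x, exists2 e, F e & fdom e x) &
      forall e e', F e -> F e' -> H_related e e'].

Definition H_admissible (h : bform E) (N : endo_field E) (F : set (frame E))
    (e : frame E) : Prop :=
  admissible h N e /\ forall e', F e' -> H_related e' e.

Definition H_nilpotent_conn (h : bform E)
    (nabla : forall x : M, tvec M -> section E -> E x)
    (N : endo_field E) (F : set (frame E)) : Prop :=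
  H_nilpotent h N F /\
  forall e, F e -> forall x v, fdom e x -> tangent x v ->
    exists2 w : 'M[R]_(rk n), lie_algebra Hgroup w &
      forall j, nabla x v (fun y => fmul (e y) (I'eps eps) j) =
                fmul (e x) (I'eps eps *m w) j.

(* [p] has the properties characterizing pi_N^x. *)
Definition is_dual_subbundle (h : bform E) (N : endo_field E) (F : set (frame E))
    (p : forall x : M, {vspace E x}) : Prop :=
  [/\ is_subbundle (n + n) p, light_like h p &
      forall e, H_admissible h N F e -> forall x, fdom e x ->
        p x = <<[seq xi' eps (e x) k | k : 'I_(n + n)]>>%VS].

(* [(N', F')] has the properties characterizing N^x. *)
Definition is_dual_structure (h : bform E) (N : endo_field E) (F : set (frame E))
    (N' : endo_field E) (F' : set (frame E)) : Prop :=
  [/\ nilpotent_structure h N', H_nilpotent h N' F' &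
      forall e', H_admissible h N' F' e' ->
        exists e, [/\ H_admissible h N F e, fdom e = fdom e' &
                     forall x i, fdom e' x -> e' x i = flip (e x) i]].

End Nilpotent.

(* Main.v *)
Require Import Defs.
From HB Require Import structures.
From mathcomp Require Import all_boot all_order all_algebra.
From mathcomp Require Import all_classical all_reals all_analysis.
From mathcomp Require Import ring.

Set Implicit Arguments.
Unset Strict Implicit.
Unset Printing Implicit Defensive.

Import Order.TTheory GRing.Theory Num.Theory.
Import numFieldNormedType.Exports.

Local Open Scope classical_set_scope.
Local Open Scope ring_scope.

(** Write [f = e I'] for an admissible frame [e], so that [N f = f Lambda], and put
    [Lambdax = eta Lambda eta]. The flip of [e] replaces [f] by [f eta].

    The group [H] is the set of elements of [SO(2n,2n)] that commute with both
    [Lambda] and [Lambdax] ([Hgroup_commute]). Hence giving the bundle [P] amounts to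
    giving a second endomorphism field [N'] with [N' f = f Lambdax] for the frames of
    the family ([dual_endo_exists]), and a frame is [H]-admissible for [N] if and only
    if it is adapted to the pair [N, N'] ([H_admissibleE]): the transition matrix
    of two adapted frames is an orientation-preserving isometry commuting with both
    matrices. Flipping a frame adapted to [N, N'] gives one adapted to [N', N]
    ([adapted_flip]). So [N'] with the flipped frames is the dual structure, and it is
    the only one ([dual_structure_adapted]).

    The identities [N N = N' N' = 0] and [N N' + N' N = -4] show that the kernel of
    each field is its image and that the two images are complementary, of
    dimension [2n]. Since [N'] is skew for the metric, its image is light-like; and
    comparing coefficients in [e], it is spanned by the vectors [xi'].

    Finally the connection matrix of [f] is skew because the connection is metric,
    and it commutes with [Lambda] (resp. [Lambdax]) exactly when [N] (resp. [N'])
    is parallel. The Lie algebra of [H] consists of the skew matrices commuting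
    with [Lambda] and [Lambdax] ([lie_algebra_commute] for one inclusion, and
    [lie_algebra_Hgroup], by the Cayley transform, for the converse). The condition on
    the connection therefore says that [N] and [N'] are both parallel
    ([lie_parallel]), which is symmetric in the two structures. *)

(** * Smooth functions of one real variable near 0 *)

Section OneVariable.
Context {R : realType}.

(** [f] is [k.+1] times differentiable at every [t] with [`|t| < d]. *)
Fixpoint Dk (d : R) (k : nat) (f : R -> R) : Prop :=
  (forall t, `|t| < d -> derivable f t 1) /\
  match k with 0 => True | k'.+1 => Dk d k' (derive1 f) end.

Lemma near_norm_lt (d t : R) : `|t| < d -> \forall u \near t, `|u| < d.
Proof.
move=> td; have dt : 0 < d - `|t| by rewrite subr_gt0.
near=> u.
have ut : `|t - u| < d - `|t|.
  by near: u; exact: (@cvgr_dist_lt _ _ _ _ _ id t).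
have := ler_normB t (t - u); rewrite opprB addrC subrK => h.
by apply: (le_lt_trans h); rewrite addrC -ltrBrDr.
Unshelve. all: by end_near. Qed.

Lemma Dk_ext d k f g : (forall t, `|t| < d -> f t = g t) -> Dk d k f -> Dk d k g.
Proof.
elim: k f g => [|k IH] f g fg [df hf];
  have nfg t : `|t| < d -> \forall u \near t, f u = g u
    by move=> /near_norm_lt; apply: filterS => u; exact: fg.
- by split; [move=> t td; apply: near_eq_derivable (df t td); exact: nfg|].
split; first by move=> t td; apply: near_eq_derivable (df t td); exact: nfg.
by apply: IH hf => t td; rewrite !derive1E; apply: near_eq_derive; exact: nfg.
Qed.

Lemma DkW d k f : Dk d k.+1 f -> Dk d k f.
Proof. by elim: k f => [|k IH] f [df hf]; split=> //; exact: IH. Qed.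

Lemma Dk_derivable d k f t : Dk d k f -> `|t| < d -> derivable f t 1.
Proof. by case: k => [|k] [df _] td; exact: df. Qed.

Lemma Dk_cst d k c : Dk d k (fun=> c).
Proof.
elim: k c => [|k IH] c; split=> //.
by apply: Dk_ext (IH 0) => t _; rewrite derive1_cst.
Qed.

Lemma Dk_id d k : Dk d k id.
Proof.
case: k => [|k]; split=> //.
by apply: Dk_ext (Dk_cst d k 1) => t _; rewrite derive1E derive_id.
Qed.

Lemma DkD d k f g : Dk d k f -> Dk d k g -> Dk d k (fun t => f t + g t).
Proof.
elim: k f g => [|k IH] f g [df hf] [dg hg].
  by split; [move=> t td; apply: derivableD; [exact: df|exact: dg]|].
split; first by move=> t td; apply: derivableD; [exact: df|exact: dg].
apply: Dk_ext (IH _ _ hf hg) => t td.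
by rewrite !derive1E deriveD; [|exact: df|exact: dg].
Qed.

Lemma DkM d k f g : Dk d k f -> Dk d k g -> Dk d k (fun t => f t * g t).
Proof.
elim: k f g => [|k IH] f g hf hg; have [df f1] := hf; have [dg g1] := hg.
  by split; [move=> t td; apply: derivableM; [exact: df|exact: dg]|].
split; first by move=> t td; apply: derivableM; [exact: df|exact: dg].
apply: Dk_ext (DkD (IH _ _ (DkW hf) g1) (IH _ _ (DkW hg) f1)) => t td.
by rewrite !derive1E deriveM; [|exact: df|exact: dg].
Qed.

Lemma DkV d k f : (forall t, `|t| < d -> f t != 0) -> Dk d k f ->
  Dk d k (fun t => (f t)^-1).
Proof.
move=> f0; elim: k => [|k IH] hf; have [df f1] := hf.
  by split; [move=> t td; apply: derivableV; [exact: f0|exact: df]|].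
split; first by move=> t td; apply: derivableV; [exact: f0|exact: df].
have hV := IH (DkW hf).
apply: Dk_ext (DkM (Dk_cst d k (-1)) (DkM (DkM hV hV) f1)) => t td.
rewrite !derive1E deriveV; [|exact: f0|exact: df].
by rewrite /GRing.scale/= mulN1r mulNr -expr2 exprVn.
Qed.

Lemma Dk_sum d k (I : Type) (s : seq I) (P : pred I) (f : I -> R -> R) :
  (forall i, Dk d k (f i)) -> Dk d k (fun t => \sum_(i <- s | P i) f i t).
Proof.
move=> hf; elim: s => [|i s IH].
  by apply: Dk_ext (Dk_cst d k 0) => t _; rewrite big_nil.
case Pi : (P i); last by apply: Dk_ext IH => t _; rewrite big_cons Pi.
by apply: Dk_ext (DkD (hf i) IH) => t _; rewrite big_cons Pi.
Qed.

Lemma Dk_prod d k (I : Type) (s : seq I) (P : pred I) (f : I -> R -> R) :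
  (forall i, Dk d k (f i)) -> Dk d k (fun t => \prod_(i <- s | P i) f i t).
Proof.
move=> hf; elim: s => [|i s IH].
  by apply: Dk_ext (Dk_cst d k 1) => t _; rewrite big_nil.
case Pi : (P i); last by apply: Dk_ext IH => t _; rewrite big_cons Pi.
by apply: Dk_ext (DkM (hf i) IH) => t _; rewrite big_cons Pi.
Qed.

Lemma Dk_det d k r (A : R -> 'M[R]_r) :
  (forall i j, Dk d k (fun t => A t i j)) -> Dk d k (fun t => \det (A t)).
Proof.
by move=> hA; apply: Dk_sum => s; apply: DkM; [exact: Dk_cst|exact: Dk_prod].
Qed.

Lemma Dk_invmx d k r (A : R -> 'M[R]_r) :
  (forall t, `|t| < d -> A t \in unitmx) ->
  (forall i j, Dk d k (fun t => A t i j)) ->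
  forall i j, Dk d k (fun t => invmx (A t) i j).
Proof.
move=> uA hA i j.
suff : Dk d k (fun t => (\det (A t))^-1 * cofactor (A t) j i).
  by apply: Dk_ext => t td; rewrite /invmx uA// !mxE.
apply: DkM.
  apply: DkV; last exact: Dk_det.
  by move=> t /uA; rewrite unitmxE unitfE.
apply: DkM; first exact: Dk_cst.
by apply: Dk_det => a b; apply: Dk_ext (hA (lift j a) (lift i b)) => t _;
  rewrite !mxE.
Qed.

Lemma Dk_derive1n d f : (forall k, Dk d k f) ->
  forall k t, `|t| < d -> derivable (derive1n k f) t 1.
Proof.
move=> hf k t td; have := hf k.
elim: k f {hf} => [|k IH] f [df hf]; first exact: df.
by rewrite derive1Sn; exact: IH.
Qed.

End OneVariable.

(** * Smooth functions on open subsets of a manifold *)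

Section SeveralVariables.
Context {R : realType} {m : nat}.
Implicit Types (U V : set 'rV[R]_m) (f g : 'rV[R]_m -> R).

Lemma Ck_derivable k U f j x : Ck k.+1 U f -> U x -> derivable f x (delta_mx 0 j).
Proof. by move=> [_ /(_ j)[df _]]; exact: df. Qed.

(** Being of class [C^k] is a local property; the values of [f] off [U] play no
    role when [U] is open. *)
Lemma Ck_local k U f :
  (forall x, U x -> exists V g, [/\ open V, V x, Ck k V g &
     forall y, V y -> g y = f y]) -> Ck k U f.
Proof.
have nbg V f' g (oV : open V) (e : forall y, V y -> g y = f' y) y :
    V y -> \forall z \near y, g z = f' z.
  by move=> Vy; apply: filterS (open_nbhs_nbhs (conj oV Vy)); exact: e.
have ctn V f' g : open V -> (forall y, V y -> g y = f' y) -> forall y, V y ->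
    {for y, continuous g} -> {for y, continuous f'}.
  move=> oV e y Vy cg; rewrite /prop_for /continuous_at -(e _ Vy).
  apply: cvg_trans cg; apply: (@near_eq_cvg _ _ (nbhs y)).
  exact: nbg _ _ _ oV e _ Vy.
elim: k U f => [|k IH] U f loc; split.
- by move=> x /loc[V [g [oV Vx [cg _] e]]]; apply: (ctn V f g) => //; exact: cg.
- by [].
- by move=> x /loc[V [g [oV Vx [cg _] e]]]; apply: (ctn V f g) => //; exact: cg.
move=> j; split.
  move=> x /loc[V [g [oV Vx Cg e]]].
  apply: (near_eq_derivable _ (Ck_derivable Cg Vx)).
  exact: nbg _ _ _ oV e _ Vx.
apply: IH => x /loc[V [g [oV Vx [_ /(_ j)[_ Cg]] e]]].
exists V, (fun x => 'D_(delta_mx 0 j) g x); split=> // y Vy.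
by apply: near_eq_derive; exact: nbg _ _ _ oV e _ Vy.
Qed.

Lemma Ck_ext k U f g : open U -> (forall x, U x -> f x = g x) -> Ck k U f -> Ck k U g.
Proof. by move=> oU e Cf; apply: Ck_local => x Ux; exists U, f. Qed.

Lemma CkS k U V f : V `<=` U -> Ck k U f -> Ck k V f.
Proof.
elim: k f => [|k IH] f VU [cf hf]; split; [by move=> x /VU; exact: cf|by []
  |by move=> x /VU; exact: cf|].
move=> j; have [df h] := hf j; split; first by move=> x /VU; exact: df.
exact: IH.
Qed.

Lemma CkW k U f : Ck k.+1 U f -> Ck k U f.
Proof.
elim: k f => [|k IH] f [cf hf]; split; [exact: cf|by []|exact: cf|].
by move=> j; have [df h] := hf j; split; [exact: df|exact: IH].
Qed.

Lemma Ck_cst k U c : open U -> Ck k U (fun=> c).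
Proof.
elim: k c => [|k IH] c oU; split; [by move=> x _; exact: cst_continuous|by []
  |by move=> x _; exact: cst_continuous|].
move=> j; split; first by move=> x _; exact: derivable_cst.
by apply: (Ck_ext oU) (IH 0 oU) => x _; rewrite derive_cst.
Qed.

Lemma CkD k U f g : open U -> Ck k U f -> Ck k U g -> Ck k U (fun x => f x + g x).
Proof.
move=> oU; elim: k f g => [|k IH] f g Cf Cg; have [cf df] := Cf; have [cg dg] := Cg;
  (split; first by move=> x Ux; apply: continuousD; [exact: cf|exact: cg]); first by [].
move=> j; split.
  by move=> x Ux; apply: derivableD; [exact: Ck_derivable Cf Ux|exact: Ck_derivable Cg Ux].
apply: (Ck_ext oU) (IH _ _ (df j).2 (dg j).2) => x Ux.
by rewrite deriveD; [|exact: Ck_derivable Cf Ux|exact: Ck_derivable Cg Ux].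
Qed.

Lemma CkM k U f g : open U -> Ck k U f -> Ck k U g -> Ck k U (fun x => f x * g x).
Proof.
move=> oU; elim: k f g => [|k IH] f g Cf Cg; have [cf df] := Cf; have [cg dg] := Cg;
  (split; first by move=> x Ux; apply: continuousM; [exact: cf|exact: cg]); first by [].
move=> j; split.
  by move=> x Ux; apply: derivableM; [exact: Ck_derivable Cf Ux|exact: Ck_derivable Cg Ux].
apply: (Ck_ext oU) (CkD oU (IH _ _ (CkW Cf) (dg j).2) (IH _ _ (CkW Cg) (df j).2)) => x Ux.
by rewrite deriveM; [|exact: Ck_derivable Cf Ux|exact: Ck_derivable Cg Ux].
Qed.

End SeveralVariables.

Section SmoothFunctions.
Context {R : realType} {m : nat} {M : manifold R m}.
Implicit Types (W : set M) (f g : M -> R).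

Lemma open_chart_image W (c : chart R M m) : open W -> atlas c ->
  open (cmap c @` (W `&` cdom c)).
Proof.
move=> oW /atlas_chart[oc oi ck _ ci].
have -> : cmap c @` (W `&` cdom c) = (cmap c @` cdom c) `&` (cinv c @^-1` (W `&` cdom c)).
  apply/seteqP; split=> [_ [x [Wx cx] <-]|y [[x cx <-]] /=].
    by split; [exists x|rewrite /= ck ?inE].
  by rewrite ck ?inE// => -[Wx _]; exists x.
rewrite openE => y [iy Wy]; rewrite /interior.
apply: filterI; first exact: open_nbhs_nbhs.
by apply: ci => //; apply: open_nbhs_nbhs; split=> //; exact: openI.
Qed.

Lemma smooth_on_local W f :
  (forall x, W x -> exists W' g, [/\ open W', W' x, smooth_on W' g &
     forall y, W' y -> g y = f y]) -> smooth_on W f.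
Proof.
move=> loc c ac k; apply: Ck_local => _ [x [Wx cx] <-].
have [W' [g [oW' W'x sg e]]] := loc x Wx.
have [_ _ ck _ _] := atlas_chart ac.
exists (cmap c @` (W' `&` cdom c)), (fun y => g (cinv c y)); split.
- exact: open_chart_image.
- by exists x.
- exact: sg.
- by move=> _ [y [W'y cy] <-]; rewrite ck ?inE// e.
Qed.

Lemma smooth_onS W W' f : W' `<=` W -> smooth_on W f -> smooth_on W' f.
Proof.
by move=> s sf c ac k; apply: CkS (sf c ac k); apply: image_subset; exact: setSI.
Qed.

Lemma smooth_on_ext W f g : open W -> (forall x, W x -> f x = g x) ->
  smooth_on W f -> smooth_on W g.
Proof. by move=> oW e sf; apply: smooth_on_local => x Wx; exists W, f. Qed.

Lemma smooth_on_cst W a : open W -> smooth_on W (fun=> a).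
Proof. by move=> oW c ac k; apply: Ck_cst; exact: open_chart_image. Qed.

Lemma smooth_onD W f g : open W -> smooth_on W f -> smooth_on W g ->
  smooth_on W (fun x => f x + g x).
Proof.
move=> oW sf sg c ac k; apply: CkD; [exact: open_chart_image|exact: sf|exact: sg].
Qed.

Lemma smooth_onM W f g : open W -> smooth_on W f -> smooth_on W g ->
  smooth_on W (fun x => f x * g x).
Proof.
move=> oW sf sg c ac k; apply: CkM; [exact: open_chart_image|exact: sf|exact: sg].
Qed.

Lemma smooth_on_lin W (I : Type) (l : seq I) (c : I -> R) (f : I -> M -> R) :
  open W -> (forall i, smooth_on W (f i)) ->
  smooth_on W (fun x => \sum_(i <- l) c i * f i x).
Proof.
move=> oW sf; elim: l => [|i l IH].
  by apply: smooth_on_ext (smooth_on_cst 0 oW) => // x _; rewrite big_nil.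
apply: smooth_on_ext (smooth_onD oW (smooth_onM oW (smooth_on_cst (c i) oW) (sf i)) IH) => //.
by move=> x _; rewrite big_cons.
Qed.

Lemma tderiv_cst (c : chart R M m) x v W f a : open W -> W x -> atlas c -> cdom c x ->
  (forall y, W y -> f y = a) -> tderiv c x v f = 0.
Proof.
move=> oW Wx ac cx fa; apply: big1 => j _.
have [_ _ ck _ _] := atlas_chart ac.
rewrite (@near_eq_derive _ _ _ _ (cst a)) ?derive_cst ?mulr0//.
near=> y; have : (cmap c @` (W `&` cdom c)) y.
  near: y; apply: open_nbhs_nbhs; split; first exact: open_chart_image.
  by exists x.
by move=> [z [Wz cz] <-]; rewrite ck ?inE// fa.
Unshelve. all: by end_near. Qed.

End SmoothFunctions.

Section SmoothSections.
Context {R : realType} {m r : nat} {M : manifold R m} {E : oriented_bundle M r}.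
Implicit Types (W : set M) (s : section E) (f : M -> R).

Lemma smooth_section_local W s :
  (forall x, W x -> exists W' s', [/\ open W', W' x, smooth_section W' s' &
     forall y, W' y -> s' y = s y]) -> smooth_section W s.
Proof.
move=> loc t j bt; apply: smooth_on_local => x [Wx tx].
have [W' [s' [oW' W'x ss e]]] := loc x Wx.
exists (W' `&` tdom t), (fun x => tmap t x (s' x) 0 j); split.
- by apply: openI => //; exact: batlas_open.
- by [].
- exact: ss.
- by move=> y [W'y _]; rewrite e.
Qed.

Lemma smooth_section_ext W s s' : open W -> (forall x, W x -> s x = s' x) ->
  smooth_section W s -> smooth_section W s'.
Proof. by move=> oW e ss; apply: smooth_section_local => x Wx; exists W, s. Qed.

Lemma smooth_sectionS W W' s : W' `<=` W -> smooth_section W s -> smooth_section W' s.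
Proof. by move=> s' ss t j bt; apply: smooth_onS (ss t j bt); exact: setSI. Qed.

Lemma smooth_section0 W : open W -> smooth_section W (fun x => 0 : E x).
Proof.
move=> oW t j bt.
have oWt : open (W `&` tdom t) by apply: openI => //; exact: batlas_open.
by apply: smooth_on_ext (smooth_on_cst 0 oWt) => // x _; rewrite linear0 mxE.
Qed.

Lemma smooth_sectionD W s s' : open W -> smooth_section W s -> smooth_section W s' ->
  smooth_section W (fun x => s x + s' x).
Proof.
move=> oW ss ss' t j bt.
have oWt : open (W `&` tdom t) by apply: openI => //; exact: batlas_open.
apply: smooth_on_ext (smooth_onD oWt (ss t j bt) (ss' t j bt)) => // x _.
by rewrite linearD mxE.
Qed.

Lemma smooth_sectionZ W f s : open W -> smooth_on W f -> smooth_section W s ->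
  smooth_section W (fun x => f x *: s x).
Proof.
move=> oW sf ss t j bt.
have oWt : open (W `&` tdom t) by apply: openI => //; exact: batlas_open.
have sf' : smooth_on (W `&` tdom t) f by apply: smooth_onS sf => x [].
apply: smooth_on_ext (smooth_onM oWt sf' (ss t j bt)) => // x _.
by rewrite linearZ mxE.
Qed.

Lemma smooth_section_sum W (I : Type) (l : seq I) (f : I -> M -> R) (s : I -> section E) :
  open W -> (forall i, smooth_on W (f i)) -> (forall i, smooth_section W (s i)) ->
  smooth_section W (fun x => \sum_(i <- l) f i x *: s i x).
Proof.
move=> oW sf ss; elim: l => [|i l IH].
  by apply: smooth_section_ext (smooth_section0 oW) => // x _; rewrite big_nil.
apply: smooth_section_ext (smooth_sectionD oW (smooth_sectionZ oW (sf i) (ss i)) IH) => //.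
by move=> x _; rewrite big_cons.
Qed.

Lemma smooth_section_fmul W (b : forall x, 'I_r -> E x) (A : 'M[R]_r) j :
  open W -> (forall i, smooth_section W (fun x => b x i)) ->
  smooth_section W (fun x => fmul (b x) A j).
Proof.
by move=> oW sb; apply: smooth_section_sum => // i; exact: smooth_on_cst.
Qed.

End SmoothSections.

(** * The group [H] as a commutant, and its Lie algebra *)

(* Normalises products of block matrices with entries 0 and +-1. *)
Local Notation mxsimp := (mulmx1, mul1mx, mulmx0, mul0mx, mulmxN, mulNmx,
  opprK, addr0, add0r, oppr0).

Section MatrixAlgebra.
Context {R : realType} {n : nat}.
Local Notation Mat := 'M[R]_(rk n).
Local Notation eta := Defs.eta.

(** The matrix of the dual structure in a frame [e I'] of the original one: the
    flip of frames is right multiplication by [eta], and it commutes with [I']. *)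
Definition Lambdax : Mat := eta *m Lambda *m eta.

(* The square blocks of [Lambda] are a complex structure and a paracomplex
   structure that anticommute. *)
Let cJ : 'M[R]_(n + n) := block_mx 0 (- 1%:M) 1%:M 0.
Let cK : 'M[R]_(n + n) := block_mx 0 1%:M 1%:M 0.

Lemma etaK : eta *m eta = 1%:M :> Mat.
Proof. by rewrite mulmx_block !mxsimp -scalar_mx_block. Qed.

Lemma tr_eta : eta^T = eta :> Mat.
Proof. by rewrite tr_block_mx linearN/= !trmx1 !trmx0. Qed.

Lemma det_eta : \det (eta : Mat) = 1.
Proof.
rewrite det_ublock det1 mul1r.
rewrite (_ : - 1%:M = (-1)%:M); last by rewrite raddfN.
by rewrite det_scalar -signr_odd addnn odd_double.
Qed.

Lemma Ieps_sqr eps : Ieps eps *m Ieps eps = 1%:M :> 'M[R]_n.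
Proof.
rewrite mulmx_diag; apply/matrixP => i j; rewrite !mxE /deps /sgn.
by case: ifP => _; case: eps; rewrite ?mulrNN ?mulr1.
Qed.

Lemma I'epsK eps : I'eps eps *m I'eps eps = 1%:M :> Mat.
Proof. by rewrite !mulmx_block !mxsimp Ieps_sqr -!scalar_mx_block. Qed.

Lemma tr_I'eps eps : (I'eps eps)^T = I'eps eps :> Mat.
Proof. by rewrite !tr_block_mx tr_diag_mx !trmx1 !trmx0. Qed.

Lemma I'eps_eta eps : I'eps eps *m eta = eta *m I'eps eps :> Mat.
Proof. by rewrite !mulmx_block !mxsimp. Qed.

Lemma det_I'eps_neq0 eps : \det (I'eps eps : Mat) != 0.
Proof.
by rewrite -unitfE -unitmxE; have [] := mulmx1_unit (I'epsK eps).
Qed.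

Lemma LambdaE : Lambda = block_mx cJ cK cK cJ :> Mat.
Proof. by []. Qed.

Lemma LambdaxE : Lambdax = block_mx cJ (- cK) (- cK) cJ :> Mat.
Proof. by rewrite /Lambdax !mulmx_block !mxsimp. Qed.

Let cJ_sqr : cJ *m cJ = - 1%:M.
Proof. by rewrite !mulmx_block !mxsimp scalar_mx_block opp_block_mx oppr0. Qed.

Let cK_sqr : cK *m cK = 1%:M.
Proof. by rewrite !mulmx_block !mxsimp -scalar_mx_block. Qed.

Let cJK : cJ *m cK = - (cK *m cJ).
Proof. by rewrite !mulmx_block !mxsimp opp_block_mx !mxsimp. Qed.

Lemma Lambda_sqr : Lambda *m Lambda = 0 :> Mat.
Proof.
by rewrite LambdaE mulmx_block cJ_sqr cK_sqr cJK !(addNr, subrr) block_mx0.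
Qed.

Lemma Lambdax_sqr : Lambdax *m Lambdax = 0 :> Mat.
Proof.
have -> : Lambdax *m Lambdax = eta *m Lambda *m (eta *m eta) *m Lambda *m eta.
  by rewrite /Lambdax !mulmxA.
by rewrite etaK mulmx1 -(mulmxA eta) Lambda_sqr mulmx0 mul0mx.
Qed.

Lemma Lambdax_skew : Lambdax^T *m eta = - (eta *m Lambdax) :> Mat.
Proof.
have cJT : cJ^T = - cJ.
  by rewrite tr_block_mx opp_block_mx linearN/= !trmx1 !trmx0 !mxsimp.
have cKT : cK^T = cK by rewrite tr_block_mx !trmx1 !trmx0.
rewrite LambdaxE tr_block_mx [(- cK)^T]linearN/= cJT cKT !(mulmx_block _ _ _ _ _ _ _ (- 1%:M)).
by rewrite (mulmx_block 1%:M) !(opp_block_mx, mxsimp).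
Qed.

(** With the two vanishing squares, this makes [Lambda] and [Lambdax] generate the
    Clifford algebra of a hyperbolic plane. *)
Lemma Lambda_anticomm : Lambda *m Lambdax + Lambdax *m Lambda = (- 4)%:M :> Mat.
Proof.
rewrite LambdaxE LambdaE !(mulmx_block cJ) add_block_mx.
rewrite !(mulmxN, mulNmx) cJ_sqr cK_sqr cJK.
rewrite opprK -(opprD (cK *m cJ)) subrr -raddfN -!raddfD/=.
by rewrite [RHS]scalar_mx_block; congr block_mx; congr scalar_mx; ring.
Qed.

(** [H] is the stabiliser in [SO(2n,2n)] of the pair [Lambda], [Lambdax]. *)
Lemma Hgroup_commute (A : Mat) :
  Hgroup A <-> [/\ SOnn A, A *m Lambda = Lambda *m A & A *m Lambdax = Lambdax *m A].
Proof.
split=> [[SA [a [b [c [d eA]]]]]|[SA cA cA']].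
  rewrite LambdaxE LambdaE; split; first exact: SA; rewrite eA /cJ /cK
    !(mulmx_block, opp_block_mx) !add_block_mx !mxsimp.
    by congr block_mx; congr block_mx; rewrite // addrC.
  by congr block_mx; congr block_mx; rewrite // addrC.
split=> //.
(* The half sum and the half difference of [Lambda] and [Lambdax] are
   block-diagonal and block-antidiagonal; commuting with them yields the
   pattern of blocks directly. *)
have cJA : A *m block_mx cJ 0 0 cJ = block_mx cJ 0 0 cJ *m A.
  apply: (@scalerI _ _ (2 : R)); first by rewrite pnatr_eq0.
  rewrite scalemxAr scalemxAl (_ : _ *: _ = Lambda + Lambdax) ?mulmxDr ?mulmxDl ?cA ?cA'//.
  by rewrite LambdaE LambdaxE add_block_mx subrr scale_block_mx scaler0 scaler_nat.
have cKA : A *m block_mx 0 cK cK 0 = block_mx 0 cK cK 0 *m A.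
  apply: (@scalerI _ _ (2 : R)); first by rewrite pnatr_eq0.
  rewrite scalemxAr scalemxAl (_ : _ *: _ = Lambda - Lambdax) ?mulmxBr ?mulmxBl ?cA ?cA'//.
  rewrite LambdaE LambdaxE opp_block_mx add_block_mx subrr scale_block_mx scaler0.
  by rewrite opprK scaler_nat.
move: cJA cKA; rewrite -[A]submxK -[ulsubmx A]submxK -[ursubmx A]submxK
  -[dlsubmx A]submxK -[drsubmx A]submxK.
move: (ulsubmx (ulsubmx A)) (ursubmx (ulsubmx A)) (dlsubmx (ulsubmx A)) (drsubmx (ulsubmx A))
 (ulsubmx (ursubmx A)) (ursubmx (ursubmx A)) (dlsubmx (ursubmx A)) (drsubmx (ursubmx A))
 (ulsubmx (dlsubmx A)) (ursubmx (dlsubmx A)) (dlsubmx (dlsubmx A)) (drsubmx (dlsubmx A))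
 (ulsubmx (drsubmx A)) (ursubmx (drsubmx A)) (dlsubmx (drsubmx A)) (drsubmx (drsubmx A)).
move=> a11 a12 a21 a22 b11 b12 b21 b22 c11 c12 c21 c22 d11 d12 d21 d22.
rewrite /cJ /cK !mulmx_block !mxsimp.
move=> /eq_block_mx[/eq_block_mx[e1 e2 e3 e4] /eq_block_mx[e5 e6 e7 e8]
  /eq_block_mx[e9 e10 e11 e12] /eq_block_mx[e13 e14 e15 e16]].
move=> /eq_block_mx[/eq_block_mx[f1 f2 f3 f4] /eq_block_mx[f5 f6 f7 f8]
  /eq_block_mx[f9 f10 f11 f12] /eq_block_mx[f13 f14 f15 f16]].
exists a11, a21, b11, b12; rewrite e1 e3 e7 f14 e7 f13 f16 f15 f10 e3 f9 f12 e1 f11.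
by rewrite -e8 opprK.
Qed.

Lemma orthogonal_det1 (A : Mat) : A^T *m eta *m A = eta -> 0 < \det A -> SOnn A.
Proof.
move=> oA dA; split=> //.
have : \det A ^+ 2 = 1 by rewrite -det_eta -[in RHS]oA !det_mulmx det_tr det_eta mulr1.
by move=> /eqP; rewrite sqrp_eq1 ?ltW// => /eqP.
Qed.

End MatrixAlgebra.

Section LieAlgebra.
Context {R : realType}.

Lemma is_derive_lin (I : Type) (s : seq I) (f : I -> R -> R) (c : I -> R) (x : R) :
  (forall k, derivable (f k) x 1) ->
  is_derive x 1 (fun u => \sum_(k <- s) f k u * c k)
    (\sum_(k <- s) derive1 (f k) x * c k).
Proof.
move=> df; elim: s => [|k s IH].
  have -> : (fun u => \sum_(k <- [::]) f k u * c k) = cst 0 :> (R -> R).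
    by apply/funext => u; rewrite big_nil.
  by rewrite big_nil; exact: is_derive_cst.
have -> : (fun u => \sum_(l <- k :: s) f l u * c l) =
    (f k * cst (c k)) + (fun u => \sum_(l <- s) f l u * c l) :> (R -> R).
  by apply/funext => u; rewrite big_cons.
rewrite big_cons.
apply: is_deriveD; apply: is_derive_eq; first exact: is_deriveM (derivableP (df k)) _.
by rewrite scaler0 add0r derive1E mulrC.
Qed.

(** Differentiating [g t *m B = B *m g t] at 0. *)
Lemma lie_algebra_commute r (G : set 'M[R]_r) (B X : 'M[R]_r) :
  (forall A, G A -> A *m B = B *m A) -> lie_algebra G X -> X *m B = B *m X.
Proof.
move=> cB [d [g [d0 _ Gg dg Xg]]].
have dg0 i j : derivable (fun u => g u i j) 0 1 by apply: (dg 0%N); rewrite normr0.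
apply/matrixP => i j; rewrite !mxE.
have D1 := is_derive_lin (index_enum 'I_r) (fun k => B k j) (fun k => dg0 i k).
have D2 := is_derive_lin (index_enum 'I_r) (fun k => B i k) (fun k => dg0 k j).
under eq_bigr do rewrite Xg.
under [RHS]eq_bigr do rewrite Xg mulrC.
rewrite -(@derive_val _ _ _ _ _ _ _ D1) -(@derive_val _ _ _ _ _ _ _ D2).
apply: near_eq_derive; near=> u.
have /cB/matrixP/(_ i j) : G (g u).
  by apply: Gg; near: u; apply: near_norm_lt; rewrite normr0.
by rewrite !mxE => ->; apply: eq_bigr => k _; rewrite mulrC.
Unshelve. all: by end_near. Qed.

(** The Cayley transform [(1 + t X / 2) (1 - t X / 2)^-1], written so that its
    derivative [X] at 0 is visible. It stands in for the exponential [exp (t X)]: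
    it is rational in [t], and maps skew matrices to isometries. *)
Definition cayley r (X : 'M[R]_r) (t : R) : 'M[R]_r :=
  1%:M + t *: (X *m invmx (1%:M - (t / 2) *: X)).

Lemma cayley0 r (X : 'M[R]_r) : cayley X 0 = 1%:M.
Proof. by rewrite /cayley scale0r addr0. Qed.

Lemma Dk_cayley_den r (X : 'M[R]_r) d k i j :
  Dk d k (fun t => (1%:M - (t / 2) *: X) i j).
Proof.
apply: Dk_ext (DkD (Dk_cst d k ((1%:M : 'M[R]_r) i j))
  (DkM (Dk_id d k) (Dk_cst d k (- (2^-1 * X i j))))) => t _.
by rewrite !mxE mulrN mulrA.
Qed.

Lemma cayley_unit r (X : 'M[R]_r) :
  exists2 d : R, 0 < d & forall t, `|t| < d -> 1%:M - (t / 2) *: X \in unitmx.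
Proof.
have : {for 0, continuous (fun t : R => \det (1%:M - (t / 2) *: X))}.
  apply: differentiable_continuous; apply/derivable1_diffP.
  apply: (@Dk_derivable _ 1 0%N); last by rewrite normr0.
  by apply: Dk_det => i j; exact: Dk_cayley_den.
move=> /cvgr_neq0 /=; rewrite mul0r scale0r subr0 det1 => /(_ (oner_neq0 _)).
move=> /nbhs_normP[d /= d0 H]; exists d => // t td.
by rewrite unitmxE unitfE; apply: H; rewrite /= sub0r normrN.
Qed.

Lemma Dk_cayley r (X : 'M[R]_r) d k :
  (forall t, `|t| < d -> 1%:M - (t / 2) *: X \in unitmx) ->
  forall i j, Dk d k (fun t => cayley X t i j).
Proof.
move=> uX i j.
pose phi t := \sum_l X i l * invmx (1%:M - (t / 2) *: X) l j.
have hphi : Dk d k phi.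
  apply: Dk_sum => l; apply: DkM; first exact: Dk_cst.
  by apply: Dk_invmx => // a b; exact: Dk_cayley_den.
apply: Dk_ext (DkD (Dk_cst d k ((1%:M : 'M[R]_r) i j)) (DkM (Dk_id d k) hphi)).
by move=> t _; rewrite !mxE.
Qed.

Lemma cayley_derive r (X : 'M[R]_r) i j : derive1 (fun t => cayley X t i j) 0 = X i j.
Proof.
have [d d0 uX] := cayley_unit X.
pose phi t := \sum_l X i l * invmx (1%:M - (t / 2) *: X) l j.
have dphi : derivable phi 0 1.
  apply: (@Dk_derivable _ d 0%N); last by rewrite normr0.
  apply: Dk_sum => l; apply: DkM; first exact: Dk_cst.
  by apply: Dk_invmx => // a b; exact: Dk_cayley_den.
have -> : (fun t => cayley X t i j) = cst ((1%:M : 'M[R]_r) i j) + id * phi.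
  by apply/funext => t; rewrite !mxE.
have d1 : derivable (id : R -> R) 0 1 by exact: derivable_id.
rewrite derive1E (deriveD (derivable_cst _ _ _) (derivableM d1 dphi)).
rewrite derive_cst add0r (deriveM d1 dphi) scale0r add0r derive_id.
rewrite /phi mul0r scale0r subr0 invmx1 /GRing.scale/= mulr1.
rewrite (bigD1 j)//= big1 => [|l lj]; first by rewrite mxE eqxx mulr1 addr0.
by rewrite mxE (negPf lj) mulr0.
Qed.

Lemma invmx_commute r (A B : 'M[R]_r) : A \in unitmx -> A *m B = B *m A ->
  invmx A *m B = B *m invmx A.
Proof.
by move=> uA cAB; rewrite -[LHS](mulmxK uA) -(mulmxA _ B) -cAB mulKmx.
Qed.

Lemma cayley_commute r (X B : 'M[R]_r) t : 1%:M - (t / 2) *: X \in unitmx ->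
  X *m B = B *m X -> cayley X t *m B = B *m cayley X t.
Proof.
move=> uX cB; rewrite mulmxDl mulmxDr mul1mx mulmx1 -scalemxAl -scalemxAr.
congr (_ + _ *: _); rewrite -mulmxA invmx_commute ?mulmxA ?cB//.
by rewrite mulmxBl mulmxBr mul1mx mulmx1 -scalemxAl -scalemxAr cB.
Qed.

Lemma cayleyE r (X : 'M[R]_r) t : 1%:M - (t / 2) *: X \in unitmx ->
  cayley X t = (1%:M + (t / 2) *: X) *m invmx (1%:M - (t / 2) *: X).
Proof.
move=> uX; rewrite /cayley -[X in X + _ = _](mulmxV uX) scalemxAl -mulmxDl.
congr (_ *m _); rewrite -addrA; congr (_ + _).
by rewrite -scaleNr -scalerDl; congr (_ *: _); field.
Qed.

Context {n : nat}.
Local Notation Mat := 'M[R]_(rk n).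
Local Notation eta := Defs.eta.

Lemma SOnn_cayley (X : Mat) t : X^T *m eta + eta *m X = 0 ->
  1%:M - (t / 2) *: X \in unitmx -> SOnn (cayley X t).
Proof.
move=> /eqP; rewrite addr_eq0 => /eqP skX uX.
set s := t / 2 in uX *; set V := 1%:M - s *: X in uX *.
pose U := 1%:M + s *: X.
have UE : U^T *m eta = eta *m V.
  have -> : U^T = 1%:M + s *: X^T by apply/matrixP => i j; rewrite !mxE eq_sym.
  rewrite mulmxDl mul1mx mulmxBr mulmx1 -scalemxAl skX.
  by rewrite -scalemxAr scalerN.
have VE : V^T *m eta = eta *m U.
  have -> : V^T = 1%:M - s *: X^T by apply/matrixP => i j; rewrite !mxE eq_sym.
  rewrite mulmxBl mul1mx mulmxDr mulmx1 -scalemxAl skX.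
  by rewrite -scalemxAr scalerN opprK.
have cUV : U *m V = V *m U.
  by rewrite mulmxBr mulmxBl mulmx1 mul1mx mulmxDl mulmxDr mul1mx mulmx1.
have gE : cayley X t = U *m invmx V by rewrite cayleyE.
split.
  rewrite gE trmx_mul -!mulmxA (mulmxA U^T) UE -(mulmxA eta) (mulmxA V).
  rewrite -cUV mulmxK// -VE trmx_inv mulmxA mulVmx ?mul1mx//.
  by rewrite unitmx_tr.
have dUV : \det U = \det V.
  have := congr1 determinant UE; rewrite !det_mulmx det_tr det_eta mulr1 mul1r//.
by rewrite gE det_mulmx dUV -det_mulmx mulmxV// det1.
Qed.

(** The linearised equations of [H] suffice for belonging to its Lie algebra: the
    Cayley transform is a curve in [H] with the prescribed velocity. *)
Lemma lie_algebra_Hgroup (X : Mat) : X^T *m eta + eta *m X = 0 ->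
  X *m Lambda = Lambda *m X -> X *m Lambdax = Lambdax *m X -> lie_algebra Hgroup X.
Proof.
move=> skX cX cX'; have [d d0 uX] := cayley_unit X.
exists d, (cayley X); split=> //.
- exact: cayley0.
- move=> t /uX ut; apply/Hgroup_commute; split; first exact: SOnn_cayley.
  + exact: cayley_commute.
  + exact: cayley_commute.
- move=> k t i j td; apply: (@Dk_derive1n _ d) td => {}k; exact: Dk_cayley.
- by move=> i j; rewrite cayley_derive.
Qed.

End LieAlgebra.

(** * Frames of a vector space with a neutral form *)

Section LinearCombinations.
Context {R : realType} {V : vectType R}.

(** The product [b A] of a row of vectors with a rectangular matrix. *)
Definition lincomb r s (b : 'I_r -> V) (A : 'M[R]_(r, s)) : 'I_s -> V :=
  fun j => \sum_(i < r) A i j *: b i.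

Lemma eq_lincomb r s (b b' : 'I_r -> V) (A : 'M[R]_(r, s)) j :
  b =1 b' -> lincomb b A j = lincomb b' A j.
Proof. by move=> e; apply: eq_bigr => i _; rewrite e. Qed.

Lemma lincomb_mul r s t (b : 'I_r -> V) (A : 'M[R]_(r, s)) (B : 'M[R]_(s, t)) j :
  lincomb b (A *m B) j = lincomb (lincomb b A) B j.
Proof.
rewrite /lincomb; under eq_bigr do rewrite mxE scaler_suml.
rewrite exchange_big; apply: eq_bigr => k _; rewrite scaler_sumr.
by apply: eq_bigr => i _; rewrite scalerA mulrC.
Qed.

Lemma lincomb1 r (b : 'I_r -> V) j : lincomb b 1%:M j = b j.
Proof.
rewrite /lincomb (bigD1 j)//= mxE eqxx scale1r big1 ?addr0// => i ij.
by rewrite mxE (negPf ij) scale0r.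
Qed.

Lemma lincombD r s (b : 'I_r -> V) (A B : 'M[R]_(r, s)) j :
  lincomb b (A + B) j = lincomb b A j + lincomb b B j.
Proof. by rewrite /lincomb -big_split; apply: eq_bigr => i _; rewrite mxE scalerDl. Qed.

Lemma lincombN r s (b : 'I_r -> V) (A : 'M[R]_(r, s)) j :
  lincomb b (- A) j = - lincomb b A j.
Proof. by rewrite /lincomb -sumrN; apply: eq_bigr => i _; rewrite mxE scaleNr. Qed.

Lemma lincombZ r s (b : 'I_r -> V) a (A : 'M[R]_(r, s)) j :
  lincomb b (a *: A) j = a *: lincomb b A j.
Proof. by rewrite /lincomb scaler_sumr; apply: eq_bigr => i _; rewrite mxE scalerA. Qed.

Lemma lincomb_colj r s (b : 'I_r -> V) (A : 'M[R]_(r, s)) j :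
  lincomb b (col j A) 0 = lincomb b A j.
Proof. by apply: eq_bigr => i _; rewrite mxE. Qed.

Lemma lincomb0 r s (b : 'I_r -> V) j : lincomb b (0 : 'M[R]_(r, s)) j = 0.
Proof. by rewrite /lincomb big1// => i _; rewrite mxE scale0r. Qed.

Lemma lfun_lincomb (W : vectType R) (T : 'Hom(V, W)) r s (b : 'I_r -> V)
  (A : 'M[R]_(r, s)) j : T (lincomb b A j) = \sum_(i < r) A i j *: T (b i).
Proof. by rewrite linear_sum; apply: eq_bigr => i _; rewrite linearZ. Qed.

Lemma flipE n (b : 'I_(rk n) -> V) j : flip b j = lincomb b Defs.eta j.
Proof.
have etaE : Defs.eta = diag_mx (row_mx (const_mx 1) (const_mx (-1))) :> 'M[R]_(rk n).
  by rewrite diag_mx_row !diag_const_mx raddfN.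
rewrite /lincomb (bigD1 j)//= big1 => [|i ij].
  rewrite addr0 etaE mxE eqxx mulr1n mxE /flip.
  by case: fintype.splitP => k _; rewrite mxE ?scale1r ?scaleN1r.
by rewrite etaE mxE (negPf ij) mulr0n scale0r.
Qed.

(** The coefficients of [xi'] in the frame [e]. *)
Definition xi_mx n eps : 'M[R]_(rk n, n + n) :=
  col_mx 1%:M (block_mx 1%:M 0 0 (- Ieps eps)).

Lemma lincomb_col r1 r2 s (b : 'I_(r1 + r2) -> V) (A : 'M[R]_(r1, s))
    (B : 'M[R]_(r2, s)) j :
  lincomb b (col_mx A B) j =
  lincomb (b \o @lshift r1 r2) A j + lincomb (b \o @rshift r1 r2) B j.
Proof.
rewrite /lincomb big_split_ord/=.
by congr (_ + _); apply: eq_bigr => i _; rewrite ?col_mxEu ?col_mxEd.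
Qed.

Lemma lincomb_rowl r s1 s2 (b : 'I_r -> V) (A : 'M[R]_(r, s1)) (B : 'M[R]_(r, s2)) j :
  lincomb b (row_mx A B) (lshift s2 j) = lincomb b A j.
Proof. by apply: eq_bigr => i _; rewrite row_mxEl. Qed.

Lemma lincomb_rowr r s1 s2 (b : 'I_r -> V) (A : 'M[R]_(r, s1)) (B : 'M[R]_(r, s2)) j :
  lincomb b (row_mx A B) (rshift s1 j) = lincomb b B j.
Proof. by apply: eq_bigr => i _; rewrite row_mxEr. Qed.

Lemma lincomb_Ieps n eps (b : 'I_n -> V) j :
  lincomb b (Ieps eps) j = deps eps j *: b j.
Proof.
rewrite /lincomb (bigD1 j)//= big1 => [|i ij]; first by rewrite !mxE eqxx mulr1n addr0.
by rewrite !mxE (negPf ij) mulr0n scale0r.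
Qed.

Lemma xi'E n eps (b : 'I_(rk n) -> V) k : xi' eps b k = lincomb b (xi_mx n eps) k.
Proof.
rewrite /xi' lincomb_col lincomb1 /block_mx lincomb_col.
case: fintype.splitP => i ki.
  have -> : k = lshift n i by exact: val_inj.
  by rewrite !lincomb_rowl lincomb1 lincomb0 addr0.
have -> : k = rshift n i by exact: val_inj.
by rewrite !lincomb_rowr lincombN lincomb_Ieps lincomb0 add0r.
Qed.

(** The vectors [xi'] and the images of [e I'] under the dual structure, of
    coefficients [I' Lambdax] in [e], are combinations of each other; hence the two
    families have the same span. *)
Lemma xi_mx_factor n eps : exists B : 'M[R]_(n + n, rk n),
  I'eps eps *m Lambdax = xi_mx n eps *m B.
Proof.
exists (row_mx (block_mx 0 (- 1%:M) 1%:M 0) (- block_mx 0 1%:M 1%:M 0)).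
rewrite LambdaxE mul_col_row !mulmx_block !(opp_block_mx, mulmx_block, mulmxN, mulNmx).
rewrite !mxsimp.
by rewrite !opp_block_mx !oppr0.
Qed.

Lemma xi_mx_cofactor n eps : exists C : 'M[R]_(rk n, n + n),
  I'eps eps *m Lambdax *m C = xi_mx n eps.
Proof.
exists (col_mx (block_mx 0 1%:M (- 1%:M) 0) 0).
rewrite LambdaxE mulmx_block mul_block_col !mulmx0 !addr0 !mulmx_block.
rewrite !mxsimp.
rewrite !mulmx_block !opp_block_mx.
rewrite !mxsimp.
by rewrite -scalar_mx_block.
Qed.

End LinearCombinations.

Section NeutralForm.
Context {R : realType} {n : nat} {V : vectType R} (g : V -> V -> R).
Hypothesis g_sym : forall u v, g u v = g v u.
Hypothesis g_linear : forall a u v w, g (a *: u + v) w = a * g u w + g v w.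
Local Notation eta := Defs.eta.

(** [b] is pseudo-orthonormal for [g], space-like vectors first. *)
Definition orth (b : 'I_(rk n) -> V) := forall i j, g (b i) (b j) = eta i j.

Lemma g_suml I (s : seq I) (c : I -> R) (b : I -> V) w :
  g (\sum_(i <- s) c i *: b i) w = \sum_(i <- s) c i * g (b i) w.
Proof.
elim: s => [|i s IH]; rewrite ?big_nil ?big_cons ?g_linear ?IH//.
by have := g_linear (-1) 0 0 w; rewrite scaler0 add0r mulN1r addNr.
Qed.

Lemma g_lincomb r s t (b : 'I_r -> V) (A : 'M[R]_(r, s)) (B : 'M[R]_(r, t)) i j :
  g (lincomb b A i) (lincomb b B j) =
  (A^T *m (\matrix_(k, l) g (b k) (b l)) *m B) i j.
Proof.
rewrite g_suml -mulmxA mxE; apply: eq_bigr => k _; rewrite !mxE; congr (_ * _).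
by rewrite g_sym g_suml; apply: eq_bigr => l _; rewrite mxE mulrC g_sym.
Qed.

Section OneFrame.
Variable b : 'I_(rk n) -> V.
Hypothesis ob : orth b.

Lemma orth_lincomb s t (A : 'M[R]_(rk n, s)) (B : 'M[R]_(rk n, t)) i j :
  g (lincomb b A i) (lincomb b B j) = (A^T *m eta *m B) i j.
Proof.
by rewrite g_lincomb; congr ((_ *m _ *m _) i j); apply/matrixP => k l; rewrite mxE ob.
Qed.

Lemma orth_inj s (A B : 'M[R]_(rk n, s)) : lincomb b A =1 lincomb b B -> A = B.
Proof.
move=> e; suff : eta *m A = eta *m B.
  by move=> /(congr1 (mulmx eta)); rewrite !mulmxA etaK !mul1mx.
apply/matrixP => i j; have := orth_lincomb 1%:M A i j; rewrite e orth_lincomb.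
by rewrite trmx1 mul1mx.
Qed.

Lemma orth_basis : \dim {:V} = rk n -> basis_of fullv [seq b i | i : 'I_(rk n)].
Proof.
move=> dV; have -> : [seq b i | i : 'I_(rk n)] = map_tuple b (ord_tuple (rk n)) by [].
rewrite basisEfree subvf size_tuple dV leqnn !andbT; apply/freeP => k.
under eq_bigr do rewrite -tnth_nth tnth_map tnth_ord_tuple.
pose c : 'cV[R]_(rk n) := \col_i k i.
move=> k0 i; have : c = 0; last by move/matrixP/(_ i 0); rewrite !mxE.
apply: orth_inj => j; rewrite lincomb0 -[RHS]k0.
by apply: eq_bigr => l _; rewrite mxE.
Qed.

Hypothesis dV : \dim {:V} = rk n.

(** The column of coordinates of [v] in a pseudo-orthonormal frame. *)
Definition coords v : 'cV[R]_(rk n) := eta *m \col_i g v (b i).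

Lemma coordsK v : lincomb b (coords v) 0 = v.
Proof.
have : v \in <<[seq b i | i : 'I_(rk n)]>>%VS.
  by rewrite (span_basis (orth_basis dV)) memvf.
have -> : [seq b i | i : 'I_(rk n)] = map_tuple b (ord_tuple (rk n)) by [].
move=> /coord_span; under eq_bigr do rewrite -tnth_nth tnth_map tnth_ord_tuple.
pose k i := coord (map_tuple b (ord_tuple (rk n))) i v => vE.
have {}vE : v = lincomb b (\col_i k i) 0.
  by rewrite [LHS]vE; apply: eq_bigr => i _; rewrite mxE.
rewrite [RHS]vE; congr (lincomb _ _ _); rewrite /coords vE.
rewrite -[RHS]mul1mx -etaK -mulmxA; congr (_ *m _); apply/colP => i.
by rewrite mxE -{1}(lincomb1 b i) g_sym orth_lincomb trmx1 mul1mx.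
Qed.

Lemma orth_spanning (v : V) : exists c : 'cV_(rk n), v = lincomb b c 0.
Proof. by exists (coords v); rewrite coordsK. Qed.

(** [T] has matrix [A] in the frame [b]. *)
Definition acts (T : 'End(V)) (A : 'M[R]_(rk n)) := forall j, T (b j) = lincomb b A j.

Lemma acts_lincomb T A s (B : 'M[R]_(rk n, s)) j : acts T A ->
  T (lincomb b B j) = lincomb b (A *m B) j.
Proof. by move=> TA; rewrite lfun_lincomb lincomb_mul; apply: eq_bigr => i _; rewrite TA. Qed.

Lemma acts_inj T S A : acts T A -> acts S A -> T = S.
Proof.
move=> TA SA; apply/lfunP => v; have [c ->] := orth_spanning v.
by rewrite (acts_lincomb _ _ TA) (acts_lincomb _ _ SA).
Qed.

Lemma acts_exists A : exists T, acts T A.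
Proof.
pose T v := lincomb b (A *m coords v) 0.
have Tl : linear T.
  move=> a u v; rewrite /T -lincombZ -lincombD scalemxAr -mulmxDr; congr (lincomb _ (_ *m _) _).
  rewrite /coords scalemxAr -mulmxDr; congr (_ *m _).
  by apply/colP => i; rewrite !mxE g_linear.
pose L : {linear V -> V} := HB.pack T (GRing.isLinear.Build _ _ _ _ T Tl).
exists (linfun L) => j; rewrite lfunE/= /T.
have -> : coords (b j) = col j 1%:M.
  by apply: orth_inj => k; rewrite ord1 coordsK lincomb_colj lincomb1.
by rewrite [col j _]colE mulmxA mulmx1 -colE lincomb_colj.
Qed.

Lemma orth_change b' : orth b' -> exists2 A : 'M[R]_(rk n),
  A^T *m eta *m A = eta & forall j, b' j = lincomb b A j.
Proof.
move=> ob'; pose A : 'M[R]_(rk n) := eta *m \matrix_(i, j) g (b' j) (b i).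
have bA j : b' j = lincomb b A j.
  rewrite -lincomb_colj -[LHS]coordsK; congr lincomb.
  by rewrite /A [col j _]colE -mulmxA -colE; congr mulmx; apply/colP => i; rewrite !mxE.
exists A => //; apply/matrixP => i j.
by rewrite -ob' !bA orth_lincomb.
Qed.

End OneFrame.

Section DualPair.
(* [T] and [S] have the matrices of [N] and of its dual in the frame [b]. *)
Variables (b : 'I_(rk n) -> V) (T S : 'End(V)).
Hypotheses (dV : \dim {:V} = rk n) (ob : orth b).
Hypotheses (TL : acts b T Lambda) (SL : acts b S Lambdax).

Lemma dual_pair_sqr v : T (T v) = 0 /\ S (S v) = 0.
Proof.
have [c ->] := orth_spanning ob dV v; split.
  by rewrite !(acts_lincomb _ _ TL) (mulmxA Lambda Lambda) Lambda_sqr mul0mx lincomb0.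
by rewrite !(acts_lincomb _ _ SL) (mulmxA Lambdax Lambdax) Lambdax_sqr mul0mx lincomb0.
Qed.

(** The relation [TS + ST = -4] recovers every vector from its images; in
    particular a vector of [ker T] is in the image of [T]. *)
Lemma dual_pair_anticomm v : v = (- 4)^-1 *: (T (S v) + S (T v)).
Proof.
have [c vc] := orth_spanning ob dV v; rewrite [in RHS]vc.
rewrite !(acts_lincomb _ _ TL) !(acts_lincomb _ _ SL) !(acts_lincomb _ _ TL).
rewrite -lincombD (mulmxA Lambda Lambdax) (mulmxA Lambdax Lambda) -mulmxDl.
rewrite Lambda_anticomm mul_scalar_mx lincombZ -vc.
by rewrite scalerA mulVf ?scale1r// oppr_eq0 pnatr_eq0.
Qed.

Lemma dual_pair_limg_lker : limg T = lker T /\ limg S = lker S.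
Proof.
split; apply/eqP; rewrite eqEsubv; apply/andP; split; apply/subvP => v.
- by move=> /memv_imgP[u _ ->]; rewrite memv_ker (dual_pair_sqr u).1.
- rewrite memv_ker => /eqP Tv; rewrite (dual_pair_anticomm v) Tv linear0 addr0.
  by rewrite -linearZ memv_img ?memvf.
- by move=> /memv_imgP[u _ ->]; rewrite memv_ker (dual_pair_sqr u).2.
- rewrite memv_ker => /eqP Sv; rewrite (dual_pair_anticomm v) Sv linear0 add0r.
  by rewrite -linearZ memv_img ?memvf.
Qed.

Lemma dual_pair_direct : (limg T + limg S)%VS = fullv /\ directv (limg T + limg S).
Proof.
split.
  apply/eqP; rewrite eqEsubv subvf/=; apply/subvP => v _.
  by rewrite (dual_pair_anticomm v) memvZ// memv_add// memv_img ?memvf.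
apply/directv_addP/eqP; rewrite -subv0; apply/subvP => v; rewrite memv_cap.
have [-> ->] := dual_pair_limg_lker; rewrite !memv_ker => /andP[/eqP Tv /eqP Sv].
by rewrite (dual_pair_anticomm v) Tv Sv !linear0 addr0 scaler0 mem0v.
Qed.

Lemma dual_pair_dim : \dim (limg S) = (n + n)%N.
Proof.
have := limg_ker_dim S fullv; rewrite capfv -dual_pair_limg_lker.2 dV.
by rewrite !addnn => /double_inj.
Qed.

Lemma dual_pair_light u v : u \in limg S -> v \in limg S -> g u v = 0.
Proof.
move=> /memv_imgP[u' _ ->] /memv_imgP[v' _ ->].
have [c ->] := orth_spanning ob dV u'; have [d ->] := orth_spanning ob dV v'.
rewrite !(acts_lincomb _ _ SL) orth_lincomb// trmx_mul.
rewrite -(mulmxA c^T) Lambdax_skew mulmxN mulNmx (mulmxA c^T) -(mulmxA (c^T *m _)).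
by rewrite (mulmxA Lambdax Lambdax) Lambdax_sqr mul0mx mulmx0 oppr0 mxE.
Qed.

Lemma dual_pair_span eps (e : 'I_(rk n) -> V) : (forall j, b j = lincomb e (I'eps eps) j) ->
  limg S = <<[seq xi' eps e k | k : 'I_(n + n)]>>%VS.
Proof.
move=> be; have SE j : S (b j) = lincomb e (I'eps eps *m Lambdax) j.
  by rewrite SL lincomb_mul; exact: eq_lincomb.
have [B EB] := @xi_mx_factor R n eps; have [C EC] := @xi_mx_cofactor R n eps.
apply/eqP; rewrite eqEsubv; apply/andP; split.
  apply/subvP => _ /memv_imgP[v _ ->]; have [c ->] := orth_spanning ob dV v.
  rewrite lfun_lincomb; apply: memv_suml => i _; rewrite memvZ// SE EB lincomb_mul.
  apply: memv_suml => k _; rewrite memvZ// -xi'E; apply: memv_span.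
  by apply: map_f; rewrite mem_enum.
apply/span_subvP => _ /mapP[k _ ->]; rewrite xi'E -EC lincomb_mul.
by apply: memv_suml => j _; rewrite memvZ// -SE memv_img ?memvf.
Qed.

End DualPair.

End NeutralForm.

(** * Frames adapted to a nilpotent structure and its dual *)

Section AdaptedFrames.
Context {R : realType} {m n : nat} {M : manifold R m} {E : oriented_bundle M (rk n)}.
Context {eps : bool} {h : bform E}.
Arguments h : clear implicits.
Hypothesis hh : neutral_metric h.
Local Notation eta := Defs.eta.
Local Notation J := (I'eps eps : 'M[R]_(rk n)).

(** The row [e I'] at the point [x]; it is again pseudo-orthonormal. *)
Definition eI (e : frame E) x : 'I_(rk n) -> E x := lincomb (e x) J.

(** The frame [e] is admissible for [N1], and [N2] has the matrix [Lambdax] in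
    [e I']. The notion is exchanged by flips, see [adapted_flip]. *)
Definition adapted (N1 N2 : endo_field E) (e : frame E) : Prop :=
  admissible eps h N1 e /\
  forall x j, fdom e x -> N2 x (fmul (e x) J j) = fmul (e x) (J *m Lambdax) j.

Lemma fiber_dim x : \dim {:E x} = rk n.
Proof.
have [b [/andP[/eqP bs /eqP bf] _]] := nm_signature hh x.
by rewrite -bs bf size_map size_enum_ord.
Qed.

Lemma orth_I'eps (V : vectType R) (g : V -> V -> R) (gs : forall u v, g u v = g v u)
    (gl : forall a u v w, g (a *: u + v) w = a * g u w + g v w) (b : 'I_(rk n) -> V) :
  orth g b -> orth g (lincomb b J).
Proof.
move=> ob i j; rewrite orth_lincomb// tr_I'eps I'eps_eta.
by rewrite -mulmxA I'epsK mulmx1.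
Qed.

Lemma admissible_orth N e x : admissible eps h N e -> fdom e x -> orth (h x) (eI e x).
Proof.
move=> [_ _ oe _] ex; apply: orth_I'eps; [exact: nm_sym|exact: nm_linear|].
by move=> i j; exact: oe.
Qed.

Lemma admissible_acts N e x : admissible eps h N e -> fdom e x ->
  acts (eI e x) (N x) Lambda.
Proof. by move=> [_ _ _ Ne] ex j; rewrite -lincomb_mul; exact: Ne. Qed.

Lemma adapted_acts N1 N2 e x : adapted N1 N2 e -> fdom e x ->
  acts (eI e x) (N2 x) Lambdax.
Proof. by move=> [_ Ne] ex j; rewrite -lincomb_mul; exact: Ne. Qed.

Lemma eI_K e x j : lincomb (eI e x) J j = e x j.
Proof. by rewrite -lincomb_mul I'epsK lincomb1. Qed.

Lemma det_Hom (V : vectType R) r (T : 'Hom(V, 'rV[R]_r)) (b : 'I_r -> V) (A : 'M[R]_r) :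
  \det (\matrix_(i, j) T (lincomb b A i) 0 j) =
  \det A * \det (\matrix_(i, j) T (b i) 0 j).
Proof.
rewrite -det_tr -[in RHS](det_tr A) -det_mulmx -det_tr; congr (\det _).
apply/matrixP => i j; rewrite !mxE lfun_lincomb summxE.
by apply: eq_bigr => k _; rewrite !mxE.
Qed.

Lemma acts_change (V : vectType R) (b b' : 'I_(rk n) -> V) (T : 'End(V)) A B :
  (forall j, b' j = lincomb b A j) -> A *m B = B *m A -> acts b T B -> acts b' T B.
Proof.
move=> bb' AB Tb j; rewrite bb' (acts_lincomb _ _ Tb) -AB lincomb_mul.
by apply: eq_lincomb => i; rewrite bb'.
Qed.

(** The transition matrices may be found point by point. *)
Lemma H_related_pointwise (e e' : frame E) :
  (forall x, fdom e x -> fdom e' x ->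
     exists2 A, Hgroup A & forall j, eI e' x j = lincomb (eI e x) A j) ->
  H_related eps e e'.
Proof.
move=> H; have /choice[A HA] : forall x, exists A, fdom e x -> fdom e' x ->
    Hgroup A /\ forall j, eI e' x j = lincomb (eI e x) A j.
  move=> x; have [[ex e'x]|ne] := pselect (fdom e x /\ fdom e' x).
    by have [A HA eA] := H x ex e'x; exists A.
  by exists 0 => ex e'x; case: ne.
exists A => x ex e'x; have [HAx eA] := HA x ex e'x; split=> // j.
by rewrite -[LHS]/(eI e' x j) eA -lincomb_mul.
Qed.

(** Two frames adapted to the same pair differ by a matrix that preserves the
    metric, the orientation and both endomorphisms, that is, by an element of [H]. *)
Lemma adapted_related N1 N2 e e' : adapted N1 N2 e -> adapted N1 N2 e' ->
  H_related eps e e'.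
Proof.
move=> ae ae'; apply: H_related_pointwise => x ex e'x.
have dx := fiber_dim x.
have oe := admissible_orth ae.1 ex; have oe' := admissible_orth ae'.1 e'x.
have [A oA eA] := orth_change (nm_sym hh (x:=x)) (nm_linear hh (x:=x)) oe dx oe'.
have cA T B : acts (eI e x) T B -> acts (eI e' x) T B -> A *m B = B *m A.
  move=> Te Te'; apply: (orth_inj (nm_sym hh (x:=x)) (nm_linear hh (x:=x)) oe) => j.
  rewrite -(acts_lincomb _ _ Te) -eA Te' lincomb_mul.
  by apply: eq_lincomb => i; rewrite eA.
exists A => //; apply/Hgroup_commute; split.
- apply: orthogonal_det1 => //; have [t bt tx] := batlas_cover E x.
  have [[_ pe _ _] _] := ae; have [[_ pe' _ _] _] := ae'.
  have := pe' t x bt tx e'x; have := pe t x bt tx ex.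
  have -> : (\matrix_(i, j) tmap t x (e' x i) 0 j) =
      \matrix_(i, j) tmap t x (lincomb (e x) (J *m A *m J) i) 0 j.
    apply/matrixP => i j; rewrite !mxE; congr ((tmap t x _) 0 j).
    rewrite -eI_K !lincomb_mul; apply: eq_lincomb => k.
    by rewrite lincomb_mul; exact: eA.
  rewrite det_Hom !det_mulmx => dE; rewrite pmulr_lgt0//.
  by rewrite mulrAC pmulr_rgt0// -expr2 exprn_even_gt0//= det_I'eps_neq0.
- exact: cA (admissible_acts ae.1 ex) (admissible_acts ae'.1 e'x).
- exact: cA (adapted_acts ae ex) (adapted_acts ae' e'x).
Qed.

(** For a family of adapted frames, being [H]-admissible is the same as being
    adapted. *)
Lemma H_admissibleE N1 N2 (F : set (frame E)) e :
  (forall e', F e' -> adapted N1 N2 e') -> (forall x, exists2 e', F e' & fdom e' x) ->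
  H_admissible eps h N1 F e <-> adapted N1 N2 e.
Proof.
move=> aF cF; split=> [[ae re]|ae]; last first.
  by split=> [|e' Fe']; [exact: ae.1|exact: adapted_related (aF _ Fe') ae].
split=> // x j ex; have [e' Fe' e'x] := cF x.
have [A /(_ x e'x ex)[/Hgroup_commute[_ _ cA] eA]] := re _ Fe'.
have eA' k : eI e x k = lincomb (eI e' x) (A x) k by rewrite -lincomb_mul; exact: eA.
have := acts_change eA' cA (adapted_acts (aF _ Fe') e'x) j.
by rewrite -lincomb_mul.
Qed.

Lemma adapted_eq N1 N2 (e e' : frame E) : fdom e = fdom e' ->
  (forall x, fdom e x -> e' x = e x) -> adapted N1 N2 e -> adapted N1 N2 e'.
Proof.
move=> dd ee [[[oe se be] pe he N1e] N2e]; split; [split|]; rewrite /is_frame/positive_frame -?dd.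
- split=> // [i|x ex]; last by rewrite ee//; exact: be.
  by apply: smooth_section_ext (se i) => // x ex; rewrite ee.
- by move=> t x bt tx ex; rewrite ee//; exact: pe.
- by move=> x i j ex; rewrite ee//; exact: he.
- by move=> x j ex; rewrite ee//; exact: N1e.
- by move=> x j ex; rewrite ee//; exact: N2e.
Qed.

Definition flip_frame (e : frame E) : frame E :=
  Frame (fdom e) (fun x => flip (e x)).

Lemma flipK (V : vectType R) (b : 'I_(rk n) -> V) : flip (flip b) = b.
Proof.
apply/funext => j; rewrite flipE (@eq_lincomb _ _ _ _ _ (lincomb b eta)).
  by rewrite -lincomb_mul etaK lincomb1.
by move=> i; rewrite flipE.
Qed.

Lemma eI_flip e x j : eI (flip_frame e) x j = lincomb (eI e x) eta j.
Proof.
rewrite -lincomb_mul I'eps_eta lincomb_mul; apply: eq_lincomb => i; exact: flipE.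
Qed.

(** Flipping an adapted frame exchanges a structure and its dual. *)
Lemma adapted_flip N1 N2 e : adapted N1 N2 e -> adapted N2 N1 (flip_frame e).
Proof.
move=> ae; have [[[oe se be] pe he N1e] N2e] := ae.
have of_ x : fdom e x -> orth (h x) (flip (e x)).
  move=> ex i j; rewrite !flipE (orth_lincomb (nm_sym hh (x:=x)) (nm_linear hh (x:=x))).
    by rewrite tr_eta etaK mul1mx.
  by move=> k l; exact: he.
have fm x A j : fmul (flip_frame e x) (J *m A) j = lincomb (eI e x) (eta *m A) j.
  rewrite [LHS]lincomb_mul [RHS]lincomb_mul; apply: eq_lincomb => i.
  by rewrite -eI_flip.
have fm1 x j : fmul (flip_frame e x) J j = lincomb (eI e x) eta j.
  exact: eI_flip.
split; [split=> /=|].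
- split=> // [i|x ex]; last first.
    apply: (orth_basis (nm_sym hh (x:=x)) (nm_linear hh (x:=x))); first exact: of_.
    exact: fiber_dim.
  apply: smooth_section_ext (smooth_section_fmul eta i oe se) => // x _.
  by rewrite /= flipE.
- move=> t x bt tx ex /=; have := pe t x bt tx ex.
  suff <- : \det (\matrix_(i, j) tmap t x (lincomb (e x) eta i) 0 j) =
    \det (\matrix_(i, j) tmap t x (flip (e x) i) 0 j) by rewrite det_Hom det_eta mul1r.
  by congr (\det _); apply/matrixP => i j; rewrite !mxE flipE.
- by move=> x i j ex; exact: of_.
- move=> x j ex; rewrite fm1 fm (acts_lincomb _ _ (adapted_acts ae ex)).
  by rewrite /Lambdax -mulmxA etaK mulmx1.
- move=> x j ex; rewrite fm1 fm (acts_lincomb _ _ (admissible_acts ae.1 ex)).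
  by rewrite /Lambdax !mulmxA etaK mul1mx.
Qed.

Lemma smooth_coords (W : set M) (b : forall x, 'I_(rk n) -> E x) (s : section E) j :
  open W -> (forall i, smooth_section W (fun x => b x i)) -> smooth_section W s ->
  smooth_on W (fun x => coords (h x) (b x) (s x) j 0).
Proof.
move=> oW sb ss.
apply: smooth_on_ext (smooth_on_lin (index_enum 'I_(rk n)) (fun k => eta j k) oW
  (fun i => nm_smooth hh oW ss (sb i))) => // x _.
by rewrite [RHS]mxE; apply: eq_bigr => k _; congr (_ * _); rewrite mxE.
Qed.

Lemma eI_smooth e : is_frame e -> forall i, smooth_section (fdom e) (fun x => eI e x i).
Proof. by move=> [oe se _] i; exact: smooth_section_fmul. Qed.

Lemma lincomb_coords e N x v : admissible eps h N e -> fdom e x ->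
  lincomb (eI e x) (coords (h x) (eI e x) v) 0 = v.
Proof.
move=> ae ex; exact: (coordsK (nm_sym hh (x:=x)) (nm_linear hh (x:=x))
  (admissible_orth ae ex) (fiber_dim x)).
Qed.

(** The dual structure, glued from its expression in the frames of the family. *)
Lemma dual_endo_exists N (F : set (frame E)) : H_nilpotent eps h N F ->
  exists N', smooth_endo N' /\ forall e, F e -> adapted N N' e.
Proof.
move=> [_ aF cF rF].
have H : forall x, exists T : 'End(E x), forall e, F e -> fdom e x ->
    acts (eI e x) T Lambdax.
  move=> x; have [e Fe ex] := cF x.
  have [T Te] := acts_exists (nm_sym hh (x:=x)) (nm_linear hh (x:=x))
    (admissible_orth (aF _ Fe) ex) (fiber_dim x) Lambdax.
  (* The choice of [e] is immaterial, as elements of [H] commute with [Lambdax]. *)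
  exists T => e' Fe' e'x.
  have [A /(_ x ex e'x)[/Hgroup_commute[_ _ cA] eA]] := rF _ _ Fe Fe'.
  by apply: acts_change cA Te => k; rewrite -lincomb_mul; exact: eA.
pose N' : endo_field E := fun x => sval (cid (H x)).
have N'E x := svalP (cid (H x)) : forall e, F e -> fdom e x ->
    acts (eI e x) (N' x) Lambdax.
have aN' e : F e -> adapted N N' e.
  by move=> Fe; split=> [|x j ex]; [exact: aF|rewrite [RHS]lincomb_mul; exact: N'E].
exists N'; split=> // W s oW ss; apply: smooth_section_local => x Wx.
have [e Fe ex] := cF x; have [[[oe se be] _ _ _] _] := aN' e Fe.
have oWe : open (W `&` fdom e) by exact: openI.
have sb i : smooth_section (W `&` fdom e) (fun x => eI e x i).
  by apply: smooth_sectionS (eI_smooth _ i) => [y []|].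
have sN i : smooth_section (W `&` fdom e) (fun x => fmul (e x) (J *m Lambdax) i).
  by apply: smooth_section_fmul => // k; apply: smooth_sectionS (se k) => y [].
have ss' : smooth_section (W `&` fdom e) s by apply: smooth_sectionS ss => y [].
(* On the domain of [e], [N' s] is the combination of the dual images of [e I'],
   with the coordinates of [s], read off by the metric, as coefficients. *)
exists (W `&` fdom e),
  (fun y => \sum_i coords (h y) (eI e y) (s y) i 0 *: fmul (e y) (J *m Lambdax) i).
split=> //; first by apply: smooth_section_sum => // i; exact: smooth_coords.
move=> y [Wy ey]; rewrite -[in RHS](lincomb_coords (s y) (aF _ Fe) ey) lfun_lincomb.
by apply: eq_bigr => i _; rewrite -(aN' _ Fe).2.
Qed.

End AdaptedFrames.

Arguments eI {R m n M E} eps e x.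
Arguments adapted {R m n M E} eps h N1 N2 e.

(** * Parallel endomorphisms *)

Section Parallel.
Context {R : realType} {m n : nat} {M : manifold R m} {E : oriented_bundle M (rk n)}.
Context {eps : bool} {h : bform E}.
Arguments h : clear implicits.
Hypothesis hh : neutral_metric h.
Context {nabla : forall x : M, tvec M -> section E -> E x}.
Arguments nabla : clear implicits.
Hypothesis hnabla : is_connection nabla.
Hypothesis hmetric : metric_connection h nabla.
Local Notation eta := Defs.eta.
Local Notation J := (I'eps eps : 'M[R]_(rk n)).

Lemma nabla_sum x v c (W : set M) (I : Type) (l : seq I) (f : I -> M -> R)
    (s : I -> section E) :
  tangent x v -> atlas c -> cdom c x -> open W -> W x ->
  (forall i, smooth_on W (f i)) -> (forall i, smooth_section W (s i)) ->
  nabla x v (fun y => \sum_(i <- l) f i y *: s i y) =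
  \sum_(i <- l) (tderiv c x v (f i) *: s i x + f i x *: nabla x v (s i)).
Proof.
move=> tv ac cx oW Wx sf ss; elim: l => [|i l IH].
  rewrite big_nil.
  (* The zero section is 0 times itself, so its derivative vanishes by Leibniz. *)
  have s0 := smooth_section0 (E := E) oW.
  have sc := smooth_on_cst (M := M) 0 oW.
  rewrite (conn_local hnabla (s' := fun y => 0 *: (0 : E y)) tv oW Wx).
  - rewrite (conn_leibniz hnabla tv ac cx oW Wx sc s0).
    by rewrite scaler0 scale0r addr0.
  - by apply: smooth_section_ext s0 => // y _; rewrite big_nil.
  - by apply: smooth_section_ext s0 => // y _; rewrite scaler0.
  - by move=> y _; rewrite big_nil scaler0.
have s1 := smooth_sectionZ oW (sf i) (ss i).
have s2 := smooth_section_sum l oW sf ss.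
rewrite big_cons -IH -(conn_leibniz hnabla tv ac cx oW Wx (sf i) (ss i)).
rewrite -(conn_additive hnabla tv oW Wx s1 s2).
apply: (conn_local hnabla tv oW Wx).
- by apply: smooth_section_ext (smooth_sectionD oW s1 s2) => // y _; rewrite big_cons.
- exact: smooth_sectionD.
- by move=> y _; rewrite big_cons.
Qed.

Lemma nabla_lincomb x v (W : set M) r s (b : 'I_r -> section E) (A : 'M[R]_(r, s)) j :
  tangent x v -> open W -> W x -> (forall i, smooth_section W (b i)) ->
  nabla x v (fun y => lincomb (fun i => b i y) A j) =
  lincomb (fun i => nabla x v (b i)) A j.
Proof.
move=> tv oW Wx sb; have [c ac cx] := atlas_cover x.
rewrite (nabla_sum _ tv ac cx oW Wx (fun i => smooth_on_cst (A i j) oW) sb).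
apply: eq_bigr => i _.
by rewrite (@tderiv_cst _ _ _ _ _ _ W _ (A i j))// scale0r add0r.
Qed.

(** The endomorphism field [T] is parallel for [nabla]: the covariant derivative
    commutes with [T] on local smooth sections. *)
Definition parallel (T : endo_field E) : Prop :=
  forall x v (W : set M) (s : section E), tangent x v -> open W -> W x ->
    smooth_section W s -> nabla x v (fun y => T y (s y)) = T x (nabla x v s).

(** [w] is the connection matrix of [nabla] in [e I'] at [x], along [v]. *)
Definition conn_mx (e : frame E) x v (w : 'M[R]_(rk n)) : Prop :=
  forall j, nabla x v (fun y => eI eps e y j) = lincomb (eI eps e x) w j.

Section OneFrame.
Variables (N : endo_field E) (e : frame E) (x : M) (v : tvec M).
Hypotheses (ae : admissible eps h N e) (ex : fdom e x) (tv : tangent x v).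

Let fe : is_frame e. Proof. by case: ae. Qed.
Let oe : open (fdom e). Proof. by case: fe. Qed.
Let se i : smooth_section (fdom e) (fun y => eI eps e y i).
Proof. exact: eI_smooth. Qed.
Let ob := admissible_orth hh ae ex.

Lemma conn_mx_exists : exists w, conn_mx e x v w.
Proof.
pose w : 'M[R]_(rk n) := \matrix_(i, j)
  coords (h x) (eI eps e x) (nabla x v (fun y => eI eps e y j)) i 0.
exists w => j; rewrite -lincomb_colj -[LHS](lincomb_coords hh _ ae ex).
by congr lincomb; apply/colP => i; rewrite /w [RHS]mxE [RHS]mxE.
Qed.

(** Differentiating the constant scalar products of the frame. *)
Lemma conn_mx_skew w : conn_mx e x v w -> w^T *m eta + eta *m w = 0.
Proof.
move=> cw; have [c ac cx] := atlas_cover x.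
apply/matrixP => i j.
have := hmetric tv ac cx oe ex (se i) (se j).
rewrite (@tderiv_cst _ _ _ _ _ _ (fdom e) _ (eta i j))//; last first.
  by move=> y ey; have := admissible_orth hh ae ey; exact.
have gs := nm_sym hh (x:=x); have gl := nm_linear hh (x:=x).
rewrite !cw -{1}(lincomb1 (eI eps e x) j) -{1}(lincomb1 (eI eps e x) i).
rewrite !(orth_lincomb gs gl ob) trmx1 mul1mx mulmx1 => e0.
by rewrite [LHS]mxE -e0 mxE.
Qed.

(** The connection matrix commutes with the matrix of an endomorphism field
    exactly when that field is parallel on the frame. *)
Lemma conn_mx_commute T B w : conn_mx e x v w ->
  (forall y, fdom e y -> acts (eI eps e y) (T y) B) ->
  (forall j, nabla x v (fun y => T y (eI eps e y j)) =
             T x (nabla x v (fun y => eI eps e y j))) <->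
  w *m B = B *m w.
Proof.
move=> cw TB.
have LE j : nabla x v (fun y => T y (eI eps e y j)) =
    lincomb (eI eps e x) (w *m B) j.
  have sB : smooth_section (fdom e) (fun y => lincomb (eI eps e y) B j).
    by apply: smooth_section_sum => // i; exact: smooth_on_cst.
  rewrite (conn_local hnabla (W := fdom e)
    (s' := fun y => lincomb (eI eps e y) B j)) //.
  - rewrite (nabla_lincomb B j tv oe ex se) lincomb_mul.
    exact: eq_lincomb.
  - by apply: smooth_section_ext sB => // y ey; rewrite TB.
  - by move=> y ey; exact: TB.
have RE j : T x (nabla x v (fun y => eI eps e y j)) =
    lincomb (eI eps e x) (B *m w) j.
  by rewrite cw (acts_lincomb _ _ (TB x ex)).
split=> [H|H j]; last by rewrite LE RE H.
apply: (orth_inj (nm_sym hh (x:=x)) (nm_linear hh (x:=x)) ob) => j.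
by rewrite -LE -RE.
Qed.

(** Parallelism along one local frame extends to all sections. *)
Lemma parallel_section T (W : set M) (s : section E) : smooth_endo T ->
  open W -> W x -> smooth_section W s ->
  (forall j, nabla x v (fun y => T y (eI eps e y j)) =
             T x (nabla x v (fun y => eI eps e y j))) ->
  nabla x v (fun y => T y (s y)) = T x (nabla x v s).
Proof.
move=> sT oW Wx ss Te; have [c ac cx] := atlas_cover x.
pose U := W `&` fdom e; have oU : open U by exact: openI.
have Ux : U x by [].
have sU i : smooth_section U (fun y => eI eps e y i).
  by apply: smooth_sectionS (se i) => y [].
have sTU i : smooth_section U (fun y => T y (eI eps e y i)) by exact: sT.
have ssU : smooth_section U s by apply: smooth_sectionS ss => y [].
pose k i y := coords (h y) (eI eps e y) (s y) i 0.
have sk i : smooth_on U (k i) by exact: smooth_coords.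
have sE y : U y -> s y = \sum_i k i y *: eI eps e y i.
  by move=> [_ ey]; rewrite -[LHS](lincomb_coords hh (s y) ae ey).
pose S : section E := fun y => \sum_i k i y *: eI eps e y i.
pose TS : section E := fun y => \sum_i k i y *: T y (eI eps e y i).
have sS : smooth_section U S by exact: smooth_section_sum.
have sTS : smooth_section U TS by exact: smooth_section_sum.
have TsE y : U y -> T y (s y) = TS y.
  by move=> Uy; rewrite sE// linear_sum; apply: eq_bigr => i _; rewrite linearZ.
rewrite (conn_local hnabla tv oU Ux ssU sS sE).
rewrite (conn_local hnabla tv oU Ux (sT _ _ oU ssU) sTS TsE).
rewrite !(nabla_sum _ tv ac cx oU Ux)// linear_sum; apply: eq_bigr => i _.
by rewrite linearD !linearZ Te.
Qed.

End OneFrame.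

(** The connection form is valued in the Lie algebra of [H] if and only if both
    structures of the dual pair are parallel. *)
Lemma lie_parallel N1 N2 (F : set (frame E)) :
  smooth_endo N1 -> smooth_endo N2 ->
  (forall e, F e -> adapted eps h N1 N2 e) -> (forall x, exists2 e, F e & fdom e x) ->
  (forall e, F e -> forall x v, fdom e x -> tangent x v ->
    exists2 w : 'M[R]_(rk n), lie_algebra Hgroup w &
      forall j, nabla x v (fun y => fmul (e y) J j) = fmul (e x) (J *m w) j) <->
  parallel N1 /\ parallel N2.
Proof.
move=> s1 s2 aF cF; split=> [H|[p1 p2] e Fe x v ex tv].
  have par T B : smooth_endo T ->
      (forall e, F e -> forall y, fdom e y -> acts (eI eps e y) (T y) B) ->
      (forall A, Hgroup A -> A *m B = B *m A) -> parallel T.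
    move=> sT TB cB x v W s tv oW Wx ss; have [e Fe ex] := cF x.
    have [w lw we] := H e Fe x v ex tv.
    have cw : conn_mx e x v w by move=> j; rewrite -lincomb_mul; exact: we.
    apply: (parallel_section (aF e Fe).1 ex tv sT oW Wx ss).
    apply/(conn_mx_commute (aF e Fe).1 ex tv cw (TB e Fe)).
    exact: lie_algebra_commute cB lw.
  split; [apply: (par N1 Lambda)|apply: (par N2 Lambdax)] => //.
  - by move=> e Fe y ey; exact: admissible_acts (aF e Fe).1 ey.
  - by move=> A /Hgroup_commute[].
  - by move=> e Fe y ey; exact: adapted_acts (aF e Fe) ey.
  - by move=> A /Hgroup_commute[].
have ae := aF e Fe; have [w cw] := conn_mx_exists v ae.1 ex.
have [[oe _ _] _ _ _] := ae.1.
exists w; last by move=> j; rewrite [RHS]lincomb_mul; exact: cw.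
apply: lie_algebra_Hgroup; first exact: (conn_mx_skew ae.1 ex tv cw).
- apply/(conn_mx_commute ae.1 ex tv cw (T := N1)) => [y ey|j].
    exact: admissible_acts ae.1 ey.
  by apply: p1 tv oe ex _; apply: eI_smooth; case: ae.1.
- apply/(conn_mx_commute ae.1 ex tv cw (T := N2)) => [y ey|j].
    exact: adapted_acts ae ey.
  by apply: p2 tv oe ex _; apply: eI_smooth; case: ae.1.
Qed.

End Parallel.

(** * The dual subbundle and the dual structure *)

Section DualStructure.
Context {R : realType} {m n : nat} {M : manifold R m} {E : oriented_bundle M (rk n)}.
Context {eps : bool} {h : bform E}.
Arguments h : clear implicits.
Hypothesis hh : neutral_metric h.
Context {N N' : endo_field E} {F : set (frame E)}.
Hypotheses (hF : H_nilpotent eps h N F) (sN' : smooth_endo N').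
Hypothesis aF : forall e, F e -> adapted eps h N N' e.

Let cF x : exists2 e, F e & fdom e x. Proof. by case: hF. Qed.

Lemma dual_pair_at x : [/\ limg (N x) = lker (N x),
  (limg (N x) + limg (N' x))%VS = fullv, directv (limg (N x) + limg (N' x)),
  \dim (limg (N' x)) = (n + n)%N &
  forall u v, u \in limg (N' x) -> v \in limg (N' x) -> h x u v = 0].
Proof.
have [e Fe ex] := cF x; have ae := aF Fe.
have gs := nm_sym hh (x:=x); have gl := nm_linear hh (x:=x).
have dx := fiber_dim hh x; have ob := admissible_orth hh ae.1 ex.
have TL := admissible_acts ae.1 ex; have SL := adapted_acts ae ex.
have [s d] := dual_pair_direct gs gl dx ob TL SL; split=> //.
- exact: (dual_pair_limg_lker gs gl dx ob TL SL).1.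
- exact: (dual_pair_dim gs gl dx ob TL SL).
- by move=> u v; exact: (dual_pair_light gs gl dx ob SL).
Qed.

Lemma limg_dual_span e x : adapted eps h N N' e -> fdom e x ->
  limg (N' x) = <<[seq xi' eps (e x) k | k : 'I_(n + n)]>>%VS.
Proof.
move=> ae ex; have ob := admissible_orth hh ae.1 ex.
by apply: (dual_pair_span (nm_sym hh (x:=x)) (nm_linear hh (x:=x)) (fiber_dim hh x) ob
  (adapted_acts ae ex)).
Qed.

Lemma H_admissible_adapted e : H_admissible eps h N F e <-> adapted eps h N N' e.
Proof. exact: H_admissibleE. Qed.

(** The dual subbundle is the image of the dual structure. *)
Lemma limg_dual_subbundle : is_dual_subbundle eps h N F (fun x => limg (N' x)).
Proof.
split; last by move=> e /H_admissible_adapted ae x; exact: limg_dual_span.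
- split=> x; first by have [] := dual_pair_at x.
  have [e Fe ex] := cF x; have ae := aF Fe; have [[[oe se _] _ _ _] _] := ae.
  exists (fdom e), (fun k y => xi' eps (e y) k); split=> //.
    move=> k; have sx : smooth_section (fdom e) (fun y => lincomb (e y) (xi_mx n eps) k).
      by apply: smooth_section_sum => // i; exact: smooth_on_cst.
    by apply: smooth_section_ext sx => // y _; rewrite xi'E.
  by move=> y; exact: limg_dual_span.
- by move=> x u v; have [_ _ _ _] := dual_pair_at x; exact.
Qed.

Lemma dual_subbundle_unique p : is_dual_subbundle eps h N F p ->
  forall x, p x = limg (N' x).
Proof.
move=> [_ _ pE] x; have [e Fe ex] := cF x.
rewrite (limg_dual_span (aF Fe) ex); apply: pE => //.
by apply/H_admissible_adapted; exact: aF.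
Qed.

Let F' : set (frame E) := [set flip_frame e | e in F].

Let aF' e : F' e -> adapted eps h N' N e.
Proof. by move=> [e0 Fe0 <-]; apply: adapted_flip => //; exact: aF. Qed.

Let cF' x : exists2 e, F' e & fdom e x.
Proof. by have [e Fe ex] := cF x; exists (flip_frame e) => //; exists e. Qed.

Lemma dual_structure_flip : is_dual_structure eps h N F N' F'.
Proof.
have nN' : nilpotent_structure eps h N'.
  by split=> // x; have [e Fe ex] := cF' x; exists e => //; exact: (aF' Fe).1.
split=> //.
  split=> // [e Fe|e e' Fe Fe']; first exact: (aF' Fe).1.
  by apply: adapted_related (aF' Fe) (aF' Fe').
move=> e /(H_admissibleE hh _ aF' cF') ae; exists (flip_frame e); split=> //.
  by apply/H_admissible_adapted; exact: adapted_flip.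
by move=> x i _; rewrite /= flipK.
Qed.

(** Every pair with the characteristic property of the dual structure has the same
    endomorphism, and its frames are adapted; this gives uniqueness. *)
Lemma dual_structure_adapted N2 F2 : is_dual_structure eps h N F N2 F2 ->
  N2 = N' /\ forall e, F2 e -> adapted eps h N' N e.
Proof.
move=> [_ [_ aF2 cF2 rF2] fl].
have aN e : F2 e -> adapted eps h N' N e.
  move=> Fe; have [e0 [/H_admissible_adapted ae0 dE eE]] : exists e0,
      [/\ H_admissible eps h N F e0, fdom e0 = fdom e &
        forall x i, fdom e x -> e x i = flip (e0 x) i].
    by apply: fl; split=> [|e' Fe']; [exact: aF2|exact: rF2].
  apply: adapted_eq (adapted_flip hh ae0) => //= x; rewrite dE => ex.
  by apply/funext => i; exact: eE.
split=> //; apply: functional_extensionality_dep => x.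
have [e Fe ex] := cF2 x; have ae := aN e Fe.
exact: (acts_inj (nm_sym hh (x:=x)) (nm_linear hh (x:=x)) (admissible_orth hh ae.1 ex)
  (fiber_dim hh x) (admissible_acts (aF2 e Fe) ex) (admissible_acts ae.1 ex)).
Qed.

Lemma dual_structure_admissible N2 F2 e : is_dual_structure eps h N F N2 F2 ->
  H_admissible eps h N2 F2 e <-> adapted eps h N' N e.
Proof.
move=> d2; have [-> aF2] := dual_structure_adapted d2.
by case: d2 => _ [_ _ cF2 _] _; exact: H_admissibleE.
Qed.

End DualStructure.

Theorem theorem4p5 (R : realType) (m n : nat) (hn : (0 < n)%N)
    (M : manifold R m) (E : oriented_bundle M (rk n))
    (h : bform E) (hh : neutral_metric h)
    (nabla : forall x : M, tvec M -> section E -> E x)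
    (hnabla : is_connection nabla) (hmetric : metric_connection h nabla)
    (eps : bool) (N : endo_field E) (hN : nilpotent_structure eps h N)
    (F : set (frame E)) (hF : H_nilpotent eps h N F) :
  (forall x, limg (N x) = lker (N x)) /\
  exists p : forall x : M, {vspace E x},
    [/\ is_dual_subbundle eps h N F p,
        (forall p', is_dual_subbundle eps h N F p' -> forall x, p' x = p x) &
        (forall x, (limg (N x) + p x)%VS = fullv /\ directv (limg (N x) + p x))] /\
    exists (N' : endo_field E) (F' : set (frame E)),
    [/\ is_dual_structure eps h N F N' F',
        (forall (N'' : endo_field E) (F'' : set (frame E)),
          is_dual_structure eps h N F N'' F'' ->
          (forall x, N'' x = N' x) /\
          (forall e, H_admissible eps h N'' F'' e <-> H_admissible eps h N' F' e)),
        (forall x, limg (N' x) = p x) &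
        (forall (N'' : endo_field E) (F'' : set (frame E)),
          is_dual_structure eps h N F N'' F'' ->
          (H_nilpotent_conn eps h nabla N F <->
           H_nilpotent_conn eps h nabla N'' F''))].
Proof.
have [N' [sN' aF]] := dual_endo_exists hh hF.
split; first by move=> x; have [] := dual_pair_at hh hF aF x.
exists (fun x => limg (N' x)); split.
  split; [exact: limg_dual_subbundle|exact: dual_subbundle_unique|].
  by move=> x; have [] := dual_pair_at hh hF aF x.
have dF := dual_structure_flip hh hF sN' aF.
exists N', [set flip_frame e | e in F]; split=> // [N2 F2 d2|N2 F2 d2].
  split=> [x|e]; first by have [->] := dual_structure_adapted hh hF aF d2.
  by rewrite (dual_structure_admissible hh hF aF e d2) (dual_structure_admissible hh hF aF e dF).
have [N2E aF2] := dual_structure_adapted hh hF aF d2.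
have [_ hF2 _] := d2; have [_ _ cF _] := hF; have [_ _ cF2 _] := hF2.
have sN := hN.1.
have P1 := lie_parallel hh hnabla hmetric sN sN' aF cF.
have P2 := lie_parallel hh hnabla hmetric sN' sN aF2 cF2.
rewrite /H_nilpotent_conn N2E in hF2 *.
by split=> -[_ H]; split=> //; [apply/P2; have [] := P1.1 H|apply/P1; have [] := P2.1 H].
Qed.
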